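(* Let $A,B\subset\Omega$ be disjoint measurable sets. Let $\mathcal{P}_{AB}^K$ be the set of probability measures $\mathbb{P}$ on $\Gamma_{AB}$ (the set of finite paths from $A$ to $B$) such that: (a) $\Phi_{\mathbb{P}}$ is absolutely continuous with respect to $K$; (b) there is a measurable $\chi\subset\Omega\times\Omega$ such that $\Phi_{\mathbb{P}}(\chi^{\mathrm c})=0$ and $(y,x)\notin\chi$ for all $(x,y)\in\chi$. Then $$\mathrm{cap}(A,B)=\sup_{\mathbb{P}\in\mathcal{P}_{AB}^K}\mathbb{E}\left[\left(\sum_{(x,y)\in\gamma}\frac{\mathrm{d}\Phi_{\mathbb{P}}}{\mathrm{d}K}(x,y)\right)^{-1}\right],$$ where $\mathbb{E}$ is expectation with respect to $\mathbb{P}$ and $\gamma$ is the random path with law $\mathbb{P}$. The identity remains true when the supremum is restricted to those $\mathbb{P}\in\mathcal{P}_{AB}^K$ that are concentrated on finite self-avoiding paths from $A$ to $B$.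
   Context: Setting. $\Omega$ is a Polish space with Borel $\sigma$-algebra $\mathcal{F}$. $k(x,\mathrm{d}y)$ is a kernel on $\Omega$ with $k(x,\Omega)<\infty$ for all $x$. $\mu$ is a $\sigma$-finite measure with $\mu(\mathrm{d}x)k(x,\mathrm{d}y)=\mu(\mathrm{d}y)k(y,\mathrm{d}x)$. Put $K(\mathrm{d}x,\mathrm{d}y)=\mu(\mathrm{d}x)k(x,\mathrm{d}y)$, a symmetric measure on $\Omega\times\Omega$. It is assumed that $K(\Omega\times\Omega)<\infty$ and that $k(x,\Omega)>0$ for $\mu$-a.a. $x$. $X=(X_t)_{t\ge0}$ is the continuous-time (minimal) Markov jump process with jump rates $k(x,\mathrm{d}y)$; $\mathbb{P}_x$ is its law given $X_0=x$, and $\tau_C=\inf\{t>0: X_t\in C\}$. $X$ is assumed irreducible and recurrent: for every measurable $C$ with $\mu(C)>0$, $\mathbb{P}_x(\tau_C<\infty)$ is positive (irreducibility) and in fact equal to $1$ (recurrence) for $\mu$-a.a. $x$. Generator. For bounded measurable $f$, $(Lf)(x)=\int_\Omega[f(y)-f(x)]\,k(x,\mathrm{d}y)$. Capacity. $h_{AB}(x)=1$ for $x\in A$, $h_{AB}(x)=0$ for $x\in B$, $h_{AB}(x)=\mathbb{P}_x(\tau_A<\tau_B)$ for $x\notin A\cup B$, and $\mathrm{cap}(A,B)=\int_A(-Lh_{AB})(x)\,\mu(\mathrm{d}x)$. Paths. $\Gamma_{AB}=\bigcup_{n\ge1}\{\gamma=(\gamma_0,\dots,\gamma_n)\in\Omega^{n+1}: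 \gamma_0\in A,\ \gamma_n\in B,\ \gamma_i\notin B \text{ for } i=1,\dots,n-1\}$, with the natural $\sigma$-algebra. Write $(x,y)\in\gamma$ if $(x,y)=(\gamma_{j-1},\gamma_j)$ for some $j\ge 1$; sums over $(x,y)\in\gamma$ are sums over the successive edges $(\gamma_{j-1},\gamma_j)$, $j=1,\dots,n$. A path is self-avoiding if its vertices are pairwise distinct. Edge measure. For a probability measure $\mathbb{P}$ on $\Gamma_{AB}$, $\Phi_{\mathbb{P}}$ is the unique measure on $\Omega\times\Omega$ with $\mathbb{E}\big[\sum_{(x,y)\in\gamma}f(x,y)\big]=\int_{\Omega\times\Omega}f\,\mathrm{d}\Phi_{\mathbb{P}}$ for every bounded measurable $f:\Omega\times\Omega\to[0,\infty)$. Conventions: densities may take values in $[0,\infty]$, $\infty^{-1}=0$, and suprema are taken in $[0,\infty]$ (so the supremum of the empty set is $0$). *)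

(* Defs.v *)
From HB Require Import structures.
From mathcomp Require Import all_boot all_order all_algebra.
From mathcomp Require Import all_classical all_reals all_analysis.
From mathcomp Require Import measurable_realfun.
Set Implicit Arguments.
Unset Strict Implicit.
Unset Printing Implicit Defensive.
Import Order.TTheory GRing.Theory Num.Theory.
Import numFieldNormedType.Exports.
Local Open Scope classical_set_scope.
Local Open Scope ring_scope.
Local Open Scope ereal_scope.

Definition is_metric (R : realType) (T : Type) (d : T -> T -> R) : Prop :=
  [/\ forall x y, (0 <= d x y)%R,
      forall x y, d x y = 0%R <-> x = y,
      forall x y, d x y = d y x &
      forall x y z, (d x z <= d x y + d y z)%R].

(* Separable and completely metrizable; the metric is not part of the
   structure. *)
Definition polish_space (R : realType) (T : topologicalType) : Prop :=
  (exists2 D : set T, countable D & dense D) /\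
  exists d : T -> T -> R,
    [/\ is_metric d,
        forall (x : T) (A : set T),
          nbhs x A <-> exists2 e : R, (0 < e)%R & [set y | (d x y < e)%R] `<=` A &
        forall u : nat -> T,
          (forall e : R, (0 < e)%R -> exists N : nat, forall m n : nat,
             (N <= m)%N -> (N <= n)%N -> (d (u m) (u n) < e)%R) ->
          exists l : T, u @ \oo --> l].

Notation borel T := (g_sigma_algebraType (@open T)).

Section joint_measure.
Context d (T : measurableType d) (R : realType).
Variables (mu : {measure set T -> \bar R}) (k : R.-ftker T ~> T).

(* K(dx,dy) = mu(dx) k(x,dy) *)
Definition joint (E : set (T * T)) : \bar R := \int[mu]_x k x (xsection E x).

Let joint0 : joint set0 = 0.
Proof. by apply: integral0_eq => x _; rewrite xsection0 measure0. Qed.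

Let joint_ge0 E : 0 <= joint E.
Proof. by apply: integral_ge0 => x _; exact: measure_ge0. Qed.

Lemma measurable_fun_joint E : measurable E ->
  measurable_fun [set: T] (fun x => k x (xsection E x)).
Proof.
move=> mE.
rewrite (_ : (fun x => _) = kfcomp k (EFin \o \1_E)); last by rewrite kfcompkindic.
apply: measurable_kfcomp => [|z]; last by rewrite lee_fin.
by apply/measurable_EFinP; exact: measurable_indic.
Qed.

Let joint_sigma_additive : semi_sigma_additive joint.
Proof.
move=> F mF tF mUF.
rewrite [X in _ --> X](_ : _ =
    \int[mu]_x \sum_(n <oo) k x (xsection (F n) x)); last first.
  apply: eq_integral => x _; rewrite xsection_bigcup.
  rewrite measure_semi_bigcup//.
  - by move=> n; exact: measurable_xsection.
  - exact: trivIset_xsection.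
  - by apply: bigcup_measurable => n _; exact: measurable_xsection.
rewrite integral_nneseries//; last by move=> n; exact: measurable_fun_joint.
apply: is_cvg_nneseries_cond => n _ _; exact: joint_ge0.
Qed.

HB.instance Definition _ :=
  isMeasure.Build _ _ _ joint joint0 joint_ge0 joint_sigma_additive.

(* mu(dx) k(x,dy) = mu(dy) k(y,dx) *)
Definition reversible : Prop :=
  forall E, measurable E -> joint E = joint ((fun xy => (xy.2, xy.1)) @^-1` E).

End joint_measure.

Definition seq_display : measure_display -> measure_display.
Proof. exact. Qed.

(* The sigma-algebra on finite sequences, seen as the disjoint union of the spaces of n-tuples. *)
Section measurable_seq.
Context d (T : measurableType d).

Definition seq_measurable (E : set (seq T)) : Prop :=
  forall n, measurable [set t : n.-tuple T | E t].

Let seq_measurable0 : seq_measurable set0.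
Proof. by move=> n; exact: measurable0. Qed.

Let seq_measurableC E : seq_measurable E -> seq_measurable (~` E).
Proof. by move=> mE n; exact: (measurableC (mE n)). Qed.

Let seq_measurable_bigcup (F : (set (seq T))^nat) :
  (forall i, seq_measurable (F i)) -> seq_measurable (\bigcup_i F i).
Proof. by move=> mF n; exact: (bigcupT_measurable _ (fun i => mF i n)). Qed.

HB.instance Definition _ := isPointed.Build (seq T) [::].
HB.instance Definition _ := @isMeasurable.Build (seq_display d) (seq T)
  seq_measurable seq_measurable0 seq_measurableC seq_measurable_bigcup.

End measurable_seq.

Section paths.
Context d (T : measurableType d).

(* [:: g0; ...; gn] |-> [:: (g0, g1); ...; (g_(n-1), gn)] *)
Definition edges (g : seq T) : seq (T * T) := zip g (behead g).

Definition edge_sum (R : realType) (f : T * T -> \bar R) (g : seq T) : \bar R :=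
  \sum_(e <- edges g) f e.

Definition paths (A B : set T) : set (seq T) :=
  [set g | exists x s y,
     [/\ g = x :: rcons s y, A x, B y & forall z, z \in s -> ~ B z]].

Definition self_avoiding : set (seq T) := [set g | uniq g].

Lemma measurable_edge_sum (R : realType) (f : T * T -> \bar R) :
  measurable_fun setT f -> measurable_fun setT (edge_sum f).
Proof.
move=> mf.
suff mn n : measurable_fun setT (fun t : n.-tuple T => edge_sum f t).
  move=> _ Y mY; rewrite setTI -[_ (_ @^-1` _)]/(seq_measurable _) => n.
  by rewrite -[X in measurable X]setTI; exact: mn.
elim: n => [|n IH].
  rewrite (_ : (fun _ => _) = cst 0)//.
  by apply/funext => t; rewrite tuple0 /edge_sum big_nil.
case: n => [|n] in IH *.
  rewrite (_ : (fun _ => _) = cst 0)//.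
  by apply/funext => -[[|x [|y s]]]//= i; rewrite /edge_sum /edges/= big_nil.
rewrite (_ : (fun _ => _) = fun t : n.+2.-tuple T =>
    f (tnth t ord0, tnth t (lift ord0 ord0)) + edge_sum f [tuple of behead t]).
  apply: emeasurable_funD.
    apply: measurableT_comp => //; apply/measurable_fun_pairP; split.
      exact: (measurable_tnth ord0).
    exact: (measurable_tnth (lift ord0 ord0)).
  apply: (@measurableT_comp _ _ _ _ _ _ (fun t : n.+1.-tuple T => edge_sum f t)
    _ (fun t : n.+2.-tuple T => [tuple of behead t])) => //.
  exact: measurable_behead.
apply/funext => -[[|x [|y s]]]//= i.
by rewrite /edge_sum /edges/= big_cons !(tnth_nth x)/=.
Qed.

End paths.
Arguments self_avoiding {d T}.

Section edge_measure.
Context d (T : measurableType d) (R : realType).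
Variable P : {measure set (seq T) -> \bar R}.

(* Expected number of edges in E; the defining property of Phi_P is
   integral_edge_measure below. *)
Definition edge_measure (E : set (T * T)) : \bar R :=
  \int[P]_g edge_sum (fun e => (\1_E e)%:E) g.

Let edge_sum_indic_ge0 (E : set (T * T)) g :
  0 <= edge_sum (fun e => (\1_E e)%:E : \bar R) g.
Proof. by apply: sume_ge0 => e _; rewrite lee_fin. Qed.

Let measurable_edge_sum_indic (E : set (T * T)) : measurable E ->
  measurable_fun setT (edge_sum (fun e => (\1_E e)%:E : \bar R)).
Proof.
move=> mE; apply: measurable_edge_sum.
by apply/measurable_EFinP; exact: measurable_indic.
Qed.

Let edge_measure0 : edge_measure set0 = 0.
Proof.
apply: integral0_eq => g _; rewrite /edge_sum big1// => e _.
by rewrite indic0.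
Qed.

Let edge_measure_ge0 E : 0 <= edge_measure E.
Proof. exact: integral_ge0. Qed.

Let edge_measure_sigma_additive : semi_sigma_additive edge_measure.
Proof.
move=> F mF tF mUF.
rewrite [X in _ --> X](_ : _ =
    \int[P]_g \sum_(n <oo) edge_sum (fun e => (\1_(F n) e)%:E) g); last first.
  apply: eq_integral => g _; rewrite nneseries_sum; last first.
    by move=> e n _; rewrite lee_fin.
  by apply: eq_bigr => e _; rewrite indic_bigcup.
rewrite integral_nneseries//; last by move=> n; exact: measurable_edge_sum_indic.
apply: is_cvg_nneseries_cond => n _ _; exact: edge_measure_ge0.
Qed.

HB.instance Definition _ := isMeasure.Build _ _ _ edge_measure
  edge_measure0 edge_measure_ge0 edge_measure_sigma_additive.

Import HBNNSimple.

Let integral_edge_measure_nnsfun (h : {nnsfun (T * T) >-> R}) :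
  \int[edge_measure]_e (h e)%:E = \int[P]_g edge_sum (fun e => (h e)%:E) g.
Proof.
rewrite integralT_nnsfun sintegralE.
transitivity (\sum_(r \in range h)
    \int[P]_g (r%:E * edge_sum (fun e => (\1_(h @^-1` [set r]) e)%:E) g)).
  apply: eq_fsbigr => r; rewrite inE => -[x _ <-].
  by rewrite ge0_integralZl// ?lee_fin//; exact: measurable_edge_sum_indic.
rewrite -ge0_integral_fsum//; last 2 first.
  by move=> r; apply: measurable_funeM; exact: measurable_edge_sum_indic.
  move=> r g _; have [r0|r0] := leP 0%R r; first by rewrite mule_ge0.
  rewrite preimage_nnfun0// /edge_sum big1 ?mule0// => e _.
  by rewrite indic0.
apply: eq_integral => g _; rewrite fsbig_finite//=.
transitivity (\sum_(r <- finmap.enum_fset (fset_set (range h))) \sum_(e <- edges g)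
    (r * \1_(h @^-1` [set r]) e)%:E).
  apply: eq_bigr => r _; rewrite /edge_sum ge0_sume_distrr//.
rewrite exchange_big/=; apply: eq_bigr => e _.
by rewrite sumEFin [in RHS]fimfunE fsbig_finite.
Qed.

Lemma integral_edge_measure (f : T * T -> \bar R) :
  measurable_fun setT f -> (forall e, 0 <= f e) ->
  \int[edge_measure]_e f e = \int[P]_g edge_sum f g.
Proof.
move=> mf f0.
pose h := nnsfun_approx measurableT mf.
have mh n : measurable_fun [set: T * T] (EFin \o h n) by exact/measurable_EFinP.
have nd_h e m n : (m <= n)%O -> ((h m e)%:E <= (h n e)%:E)%E.
  by move=> mn; rewrite lee_fin; exact/lefP/nd_nnsfun_approx.
have h_cvg e : (h n e)%:E @[n --> \oo] --> f e by exact: cvg_nnsfun_approx.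
transitivity (limn (fun n => \int[edge_measure]_e (h n e)%:E)).
  rewrite -monotone_convergence//.
  - by apply: eq_integral => e _; apply/esym/cvg_lim => //; exact: h_cvg.
  - by move=> n e _; rewrite lee_fin.
  - by move=> e _ m n; exact: nd_h.
transitivity (limn (fun n => \int[P]_g edge_sum (fun e => (h n e)%:E) g)).
  by apply: congr_lim; apply/funext => n; exact: integral_edge_measure_nnsfun.
rewrite -monotone_convergence//.
- apply: eq_integral => g _; apply/cvg_lim => //.
  rewrite /edge_sum; apply: cvg_nnesum => // e _.
  by apply: nearW => n; rewrite lee_fin.
- by move=> n; exact: (measurable_edge_sum (mh n)).
- by move=> n g _; apply: sume_ge0 => e _; rewrite lee_fin.
- by move=> g _ m n mn; apply: lee_sum => e _; exact: nd_h.
Qed.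

Lemma edge_measure_unique (Phi : {measure set (T * T) -> \bar R}) :
  (forall f : T * T -> R, measurable_fun setT f -> (forall e, 0 <= f e)%R ->
     (exists M, forall e, f e <= M)%R ->
     \int[P]_g edge_sum (EFin \o f) g = \int[Phi]_e (f e)%:E) ->
  forall E, measurable E -> Phi E = edge_measure E.
Proof.
move=> PhiP E mE.
have -> : Phi E = \int[Phi]_e (\1_E e)%:E by rewrite integral_indic// setIT.
by rewrite -(PhiP (\1_E))//; exists 1%R => e; by rewrite indicE; case: (e \in E).
Qed.

End edge_measure.

Section density.
Context d (T : measurableType d) (R : realType).
Variables nu m : {measure set T -> \bar R}.

Definition is_density (f : T -> \bar R) : Prop :=
  [/\ measurable_fun setT f, forall x, 0 <= f x &
      forall E, measurable E -> nu E = \int[m]_(x in E) f x].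

(* 'd nu '/d mu of the library requires nu to be finite, whereas
   edge_measure P need not even be sigma-finite. *)
Definition density : T -> \bar R := xget (cst 0) [set f | is_density f].

End density.

(* Minimal jump process with rates k, given by its jump chain Y and its holding
   times S on a measurable space W carrying the laws P x. *)
Section jump_process.
Context d d' (T : measurableType d) (W : measurableType d') (R : realType).
Variable k : R.-ftker T ~> T.
Variables (P : R.-pker T ~> W) (Y : nat -> W -> T) (S : nat -> W -> \bar R).

(* k(x,dy) / k(x,T), or \d_x if k(x,T) = 0 *)
Definition jump_prob (x : T) := mnormalize (k x) (\d_x).

(* P_x(Y_i \in C_i and S_i > t_i for all i < n): given the chain Y, the S_i are
   independent exponential variables of rates k(Y_i, T); rate 0 forces
   S_i = +oo *)
Fixpoint jump_law (C : nat -> set T) (t : nat -> R) (n : nat) (x : T) : \bar R :=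
  if n is n'.+1 then
    (\1_(C 0%N) x)%:E * (expR (- (t 0%N * fine (k x setT))))%:E *
    \int[jump_prob x]_y jump_law (fun i => C i.+1) (fun i => t i.+1) n' y
  else 1.

Record is_jump_process : Prop := IsJumpProcess {
  jump_chain_measurable : forall n, measurable_fun setT (Y n) ;
  holding_time_measurable : forall n, measurable_fun setT (S n) ;
  holding_time_gt0 : forall n w, 0 < S n w ;
  jump_processE : forall (C : nat -> set T) (t : nat -> R) n x,
    (forall i, measurable (C i)) -> (forall i, 0 <= t i)%R ->
    P x [set w | forall i, (i < n)%N -> C i (Y i w) /\ (t i)%:E < S i w] =
    jump_law C t n x }.

Definition jump_time (n : nat) (w : W) : \bar R := \sum_(i < n) S i w.

(* X_t, or None from the explosion time on *)
Definition state (t : R) (w : W) : option T :=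
  xget None [set Some (Y n w) | n in
    [set n | jump_time n w <= t%:E < jump_time n.+1 w]].

Definition hitting_time (C : set T) (w : W) : \bar R :=
  ereal_inf [set t%:E | t in
    [set t : R | (0 < t)%R /\ exists2 y, state t w = Some y & C y]].

Definition irreducible (mu : {measure set T -> \bar R}) : Prop :=
  forall C, measurable C -> 0 < mu C ->
    {ae mu, forall x, 0 < P x [set w | hitting_time C w < +oo]}.

Definition recurrent (mu : {measure set T -> \bar R}) : Prop :=
  forall C, measurable C -> 0 < mu C ->
    {ae mu, forall x, P x [set w | hitting_time C w < +oo] = 1}.

Definition equilibrium_potential (A B : set T) (x : T) : R :=
  if x \in A then 1%R else if x \in B then 0%R
  else fine (P x [set w | hitting_time A w < hitting_time B w]).

Definition generator (f : T -> R) (x : T) : \bar R :=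
  \int[k x]_y (f y - f x)%:E.

Definition capacity (mu : {measure set T -> \bar R}) (A B : set T) : \bar R :=
  \int[mu]_(x in A) (- generator (equilibrium_potential A B) x).

End jump_process.

Section admissible_paths.
Context d (T : measurableType d) (R : realType).
Variable K : {measure set (T * T) -> \bar R}.

Definition path_laws (A B : set T) : set (probability (seq T) R) :=
  [set P : probability (seq T) R | [/\ P (paths A B) = 1,
     edge_measure P `<< K &
     exists chi : set (T * T),
       [/\ measurable chi, edge_measure P (~` chi) = 0 &
           forall x y, chi (x, y) -> ~ chi (y, x)]]].

Definition inverse_density_mean (P : probability (seq T) R) : \bar R :=
  \int[P]_g (edge_sum (density (edge_measure P) K) g)^-1.

End admissible_paths.

(* Supremum in [0, +oo]; the supremum of the empty set is 0. *)
Definition ge0_sup {R : realType} (D : set (\bar R)) : \bar R :=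
  ereal_sup (0 |` D).

(* Main.v *)
From HB Require Import structures.
Require Import Defs.
From mathcomp Require Import all_boot all_order all_algebra.
From mathcomp Require Import all_classical all_reals all_analysis.
From mathcomp Require Import measurable_realfun.
From mathcomp Require Import ring.
Set Implicit Arguments.
Unset Strict Implicit.
Unset Printing Implicit Defensive.
Import Order.TTheory GRing.Theory Num.Theory.
Import numFieldNormedType.Exports.
Local Open Scope classical_set_scope.
Local Open Scope ring_scope.
Local Open Scope ereal_scope.

(** Let h be the equilibrium potential of A against B, let
    g(x,y) = (h(x) - h(y))^+ be its drop along an edge, and let K be the
    symmetric edge measure mu(dx) k(x,dy). Off A and B the function h is
    harmonic, which says that the flow g K is balanced there: as much of it
    leaves a point as enters it. Reversibility and summation by parts then give
      int g^2 dK = (flow out of A) = (flow into B) = cap(A,B)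
    ([energy_outflow], [energy_inflow], [capacityE]).

    Upper bound ([inverse_density_mean_le]). Let f be the density of the edge
    measure Phi of a path law P. Along a path from A to B the drops sum up to at
    least 1, so by Cauchy-Schwarz 1 / sum f <= sum g^2 / f. Integrating over
    the path law turns the right-hand side into int g^2/f dPhi, which is at most
    int g^2 dK = cap(A,B).

    Lower bound ([exists_optimal_law]). Normalised by the capacity, the flow
    g K is carried by a random path: start in B with the distribution of the
    flow into B, step from x to y with probability proportional to
    g(y,x) k(x,dy), stop in A, and read the path backwards. Balance makes
    the normalised flow through the points an excessive density for this chain.
    Therefore the expected number of traversals of an edge is at most
    g K / cap(A,B) ([path_functional_edge_sum]). As K is finite, the expected
    length is finite, so the path stops, and since dead ends have no inflow it
    stops in A ([path_functional1]). It is self-avoiding because h strictly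
    increases in the direction of growth. From Phi <= g K / cap(A,B) and
    int g^2 dK = cap(A,B) the mean of sum f is at most 1 / cap(A,B), and
    convexity of the inverse yields the value cap(A,B).

    The path law is built as a positive functional on functions of finite
    sequences. A general lemma ([integral_functional]) identifies such a
    functional with integration against the measure that it induces on sets; it
    also gives the integrals against K and against a measure with a density.

    That h is harmonic comes from the embedded jump chain: on the event that A
    is hit, which is almost sure by recurrence if mu(A) > 0, being in A before B
    does not depend on the holding times ([hitting_time_before]), and the first-step
    decomposition of the chain gives the mean value property
    ([hitting_potential_harmonic]). *)

(** * Integration against the measure of a positive functional *)

Section functional.
Context d (T : measurableType d) (R : realType).
Variables (m : {measure set T -> \bar R}) (I : (T -> \bar R) -> \bar R).
Hypothesis mI : forall E, measurable E -> m E = I (EFin \o \1_E).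
Hypothesis I_ge0 : forall f, (forall x, 0 <= f x) -> 0 <= I f.
Hypothesis IZ : forall (r : R) f, (0 <= r)%R -> measurable_fun setT f ->
  (forall x, 0 <= f x) -> I (fun x => r%:E * f x) = r%:E * I f.
Hypothesis Iseries : forall f : (T -> \bar R)^nat,
  (forall n, measurable_fun setT (f n)) -> (forall n x, 0 <= f n x) ->
  I (fun x => \sum_(n <oo) f n x) = \sum_(n <oo) I (f n).

Let I0 : I (cst 0) = 0.
Proof.
have -> : cst 0 = (fun x => 0%:E * cst 0 x) :> (T -> \bar R).
  by apply/funext => x; rewrite mule0.
by rewrite IZ// mul0e.
Qed.

Let ID f g : measurable_fun setT f -> (forall x, 0 <= f x) ->
  measurable_fun setT g -> (forall x, 0 <= g x) ->
  I (fun x => f x + g x) = I f + I g.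
Proof.
move=> mf f0 mg g0.
pose F n : T -> \bar R := if n is 0%N then f else if n is 1%N then g else cst 0.
have series2 (u : nat -> \bar R) : (forall n, 0 <= u n) ->
    (forall n, u n.+2 = 0) -> \sum_(n <oo) u n = u 0%N + u 1%N.
  move=> u0 u2; rewrite (nneseries_split 0 2)// eseries0 ?adde0.
    by rewrite add0n big_nat_recl//= big_nat1.
  by move=> [|[|i]].
have F0 n x : 0 <= F n x by case: n => [|[|n]]/=.
transitivity (I (fun x => \sum_(n <oo) F n x)).
  by congr I; apply/funext => x; rewrite series2.
rewrite Iseries//; last by case=> [|[|n]].
by rewrite series2//= => n; exact: I_ge0.
Qed.

Let Isum (J : Type) (s : seq J) (f : J -> T -> \bar R) :
  (forall j, measurable_fun setT (f j)) -> (forall j x, 0 <= f j x) ->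
  I (fun x => \sum_(j <- s) f j x) = \sum_(j <- s) I (f j).
Proof.
move=> mf f0; elim: s => [|j s IH].
  by rewrite big_nil -[RHS]I0; congr I; apply/funext => x; rewrite big_nil.
rewrite big_cons -IH -ID//.
- by congr I; apply/funext => x; rewrite big_cons.
- by apply: emeasurable_sum => i; exact: mf.
- by move=> x; apply: sume_ge0.
Qed.

Import HBNNSimple.

Let integral_nnsfun_functional (h : {nnsfun T >-> R}) :
  \int[m]_x (h x)%:E = I (EFin \o h).
Proof.
rewrite integralT_nnsfun sintegralE fsbig_finite//=.
set s := finmap.enum_fset _.
transitivity (\sum_(r <- s) I (fun x => `|r|%:E * (\1_(h @^-1` [set r]) x)%:E)).
  rewrite /s big_seq [RHS]big_seq; apply: eq_bigr => r.
  rewrite in_fset_set// inE => -[x _ <-].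
  rewrite IZ ?normr_ge0// ?ger0_norm//; first by rewrite mI.
  by apply/measurable_EFinP; exact: measurable_indic.
rewrite -Isum.
- congr I; apply/funext => x /=; rewrite [in RHS]fimfunE fsbig_finite//= -sumEFin.
  rewrite -/s big_seq [RHS]big_seq; apply: eq_bigr => r.
  by rewrite in_fset_set// inE => -[y _ <-]; rewrite ger0_norm.
- move=> r; apply: measurable_funeM.
  by apply/measurable_EFinP; exact: measurable_indic.
- by move=> r x; rewrite mule_ge0// lee_fin.
Qed.

(** A nonnegative measurable function is the sum of the successive increments
    of an increasing sequence of simple functions, so countable additivity
    carries the identity from indicators to all such functions. *)
Lemma integral_functional f : measurable_fun setT f -> (forall x, 0 <= f x) ->
  \int[m]_x f x = I f.
Proof.
move=> mf f0.
pose h := nnsfun_approx measurableT mf.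
have mh n : measurable_fun [set: T] (EFin \o h n) by exact/measurable_EFinP.
have nd_h x n p : (n <= p)%N -> (h n x <= h p x)%R.
  by move=> np; exact/lefP/nd_nnsfun_approx.
pose D n : T -> \bar R :=
  if n is n'.+1 then fun x => (h n'.+1 x - h n' x)%:E else EFin \o h 0%N.
have mD n : measurable_fun [set: T] (D n).
  case: n => [|n]//=; apply/measurable_EFinP.
  by apply: measurable_funB.
have D0 n x : 0 <= D n x.
  by case: n => [|n]/=; rewrite lee_fin// subr_ge0 nd_h.
have sumD n x : \sum_(i < n.+1) D i x = (h n x)%:E.
  elim: n => [|n IH]; first by rewrite big_ord1.
  by rewrite big_ord_recr/= IH -EFinD addrC subrK.
have fE : f = fun x => \sum_(n <oo) D n x.
  apply/funext => x; apply/esym/cvg_lim => //; rewrite -(cvg_shiftS _).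
  under eq_fun do rewrite big_mkord sumD.
  exact: cvg_nnsfun_approx.
transitivity (limn (fun n => \int[m]_x (h n x)%:E)).
  rewrite -monotone_convergence//.
  - by apply: eq_integral => x _; apply/esym/cvg_lim => //; exact: cvg_nnsfun_approx.
  - by move=> n x _; rewrite lee_fin.
  - by move=> x _ n p np; rewrite lee_fin; exact: nd_h.
rewrite [in RHS]fE Iseries//; apply/cvg_lim => //.
have ID0 n : 0 <= I (D n) by exact: I_ge0.
suff -> : (fun n => \int[m]_x (h n x)%:E) =
          (fun n => \sum_(0 <= i < n.+1) I (D i)).
  rewrite (cvg_shiftS (fun n => \sum_(0 <= i < n) I (D i))).
  exact: is_cvg_nneseries.
apply/funext => n; rewrite integral_nnsfun_functional big_mkord -Isum//.
by congr I; apply/funext => x; rewrite sumD.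
Qed.

End functional.

(** * Integrals against the symmetric edge measure and against densities *)

Section joint_integral.
Context d (T : measurableType d) (R : realType).
Variables (mu : {measure set T -> \bar R}) (k : R.-ftker T ~> T).
Implicit Types f : T * T -> \bar R.
Local Notation K := (joint mu k).

Lemma measurable_kernel_integral f : measurable_fun setT f ->
  (forall e, 0 <= f e) -> measurable_fun setT (fun x => \int[k x]_y f (x, y)).
Proof. exact: measurable_kfcomp. Qed.

Lemma integral_joint f : measurable_fun setT f -> (forall e, 0 <= f e) ->
  \int[K]_e f e = \int[mu]_x \int[k x]_y f (x, y).
Proof.
have mpair g x : measurable_fun [set: T * T] g ->
    measurable_fun setT (fun y => g (x, y) : \bar R).
  by move=> mg; exact: measurableT_comp.
apply: (@integral_functional _ _ _ K (fun f => \int[mu]_x \int[k x]_y f (x, y))).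
- move=> E mE; apply: eq_integral => x _.
  have := kfcompkindic k mE; rewrite /kfcomp => /(congr1 (fun u => u x)) <-.
  by apply: eq_integral.
- by move=> g g0; apply: integral_ge0 => x _; apply: integral_ge0.
- move=> r g r0 mg g0; rewrite -ge0_integralZl//.
  + by apply: eq_integral => x _; rewrite ge0_integralZl//; exact: mpair.
  + exact: measurable_kernel_integral.
  + by move=> x _; exact: integral_ge0.
- move=> g mg g0; rewrite -integral_nneseries//.
  + apply: eq_integral => x _; rewrite integral_nneseries// => n.
    exact: mpair.
  + by move=> n; exact: measurable_kernel_integral.
  + by move=> n x _; exact: integral_ge0.
Qed.

Lemma measurable_swap : measurable_fun [set: T * T] (fun e => (e.2, e.1)).
Proof.
apply/measurable_fun_pairP; split; first exact: measurable_snd.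
exact: measurable_fst.
Qed.

Lemma integral_joint_swap f : reversible mu k -> measurable_fun setT f ->
  (forall e, 0 <= f e) -> \int[K]_e f e = \int[K]_e f (e.2, e.1).
Proof.
have mswap g : measurable_fun [set: T * T] g ->
    measurable_fun setT (fun e => g (e.2, e.1) : \bar R).
  by move=> mg; apply: measurableT_comp mg measurable_swap.
move=> rev; apply: (@integral_functional _ _ _ K (fun f => \int[K]_e f (e.2, e.1))).
- move=> E mE; rewrite [LHS]rev//.
  have mE' : measurable ((fun e : T * T => (e.2, e.1)) @^-1` E).
    by rewrite -[X in measurable X]setTI; exact: measurable_swap.
  by rewrite -[in LHS](setIT (_ @^-1` E)) -integral_indic.
- by move=> g g0; exact: integral_ge0.
- by move=> r g r0 mg g0; rewrite ge0_integralZl//; exact: mswap.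
- by move=> g mg g0; rewrite integral_nneseries// => n; exact: mswap.
Qed.

End joint_integral.

(** The factor may be +oo; integration against the counting measure covers that
    case. *)
Lemma nneseries_Zl (R : realType) (x : \bar R) (u : (\bar R)^nat) : 0 <= x ->
  (forall n, 0 <= u n) -> \sum_(n <oo) (x * u n) = x * \sum_(n <oo) u n.
Proof.
move=> x0 u0; rewrite -!ge0_integral_count// => [|n]; last exact: mule_ge0.
by rewrite ge0_integralZl//; exact: measurableT_comp.
Qed.

Section density_integral.
Context d (T : measurableType d) (R : realType).
Variables (nu m : {measure set T -> \bar R}).

Lemma integral_is_density (f g : T -> \bar R) : is_density nu m f ->
  measurable_fun setT g -> (forall x, 0 <= g x) ->
  \int[nu]_x g x = \int[m]_x (f x * g x).
Proof.
move=> [mf f0 fE].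
apply: (@integral_functional _ _ _ nu (fun g => \int[m]_x (f x * g x))).
- move=> E mE; rewrite fE// [LHS]integral_mkcond; apply: eq_integral => x _ /=.
  by rewrite patchE indicE; case: ifPn => _; rewrite ?mule1 ?mule0.
- by move=> h h0; apply: integral_ge0 => x _; exact: mule_ge0.
- move=> r h r0 mh h0; rewrite -ge0_integralZl//.
  + by apply: eq_integral => x _; rewrite muleCA.
  + exact: emeasurable_funM.
  + by move=> x _; exact: mule_ge0.
- move=> h mh h0; rewrite -integral_nneseries//.
  + by apply: eq_integral => x _; rewrite nneseries_Zl.
  + by move=> n; exact: emeasurable_funM.
  + by move=> n x _; exact: mule_ge0.
Qed.

End density_integral.

(** * Measurability on the space of finite sequences *)

Section sequences.
Context d (T : measurableType d).
Implicit Types A B : set T.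

Lemma measurable_head : measurable_fun [set: seq T] (head point).
Proof.
move=> _ C mC; rewrite setTI -[_ (_ @^-1` C)]/(seq_measurable _) => -[|n].
  have [Cp|Cp] := pselect (C point).
    rewrite (_ : [set t | _] = setT)//; apply/seteqP; split => // t _.
    by rewrite /= tuple0.
  rewrite (_ : [set t | _] = set0)//; apply/seteqP; split => // t.
  by rewrite /= tuple0.
rewrite (_ : [set t | _] = @tnth n.+1 T ^~ ord0 @^-1` C).
  by rewrite -[X in measurable X]setTI; exact: measurable_tnth.
by apply/seteqP; split => -[[|x s] i]//=; rewrite /preimage/= (tnth_nth point).
Qed.

(* totalised by a constant tuple on the sequences of the other lengths *)
Let tuple_at (n : nat) (s : seq T) : n.-tuple T := insubd [tuple of nseq n point] s.

Let measurable_tuple_at n : measurable_fun [set: seq T] (tuple_at n).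
Proof.
move=> _ C mC; rewrite setTI -[_ (_ @^-1` C)]/(seq_measurable _) => p; have [->|pn] := eqVneq p n.
  rewrite (_ : [set t : n.-tuple T | _] = C)//.
  by apply/seteqP; split => t /=; rewrite /tuple_at valKd.
have [Cp|Cp] := pselect (C [tuple of nseq n point]).
  rewrite (_ : [set t | _] = setT)//; apply/seteqP; split => // t _ /=.
  by rewrite /tuple_at /insubd insubF//= size_tuple (negbTE pn).
rewrite (_ : [set t | _] = set0)//; apply/seteqP; split => // t /=.
by rewrite /tuple_at /insubd insubF//= size_tuple (negbTE pn).
Qed.

Lemma measurable_size n : measurable [set s : seq T | size s = n].
Proof.
move=> p; rewrite (_ : [set t : p.-tuple T | _] = [set t | p = n]).
  have [->|pn] := eqVneq p n.
    by rewrite (_ : [set _ | _] = setT)//; apply/seteqP.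
  rewrite (_ : [set _ | _] = set0)//.
  by apply/seteqP; split=> // t /= /eqP; rewrite (negbTE pn).
by apply/seteqP; split => t /=; rewrite size_tuple.
Qed.

(** On sequences of a fixed length, adding a head is a measurable map of tuples. *)
Lemma measurable_cons_seq :
  measurable_fun [set: seq T * T] (fun z => z.2 :: z.1).
Proof.
move=> _ E mE; rewrite setTI.
rewrite (_ : _ @^-1` _ = \bigcup_n (([set s | size s = n] `*` setT) `&`
  ((fun z : seq T * T => [tuple of z.2 :: tuple_at n z.1]) @^-1`
    [set t : n.+1.-tuple T | E t]))).
  apply: bigcup_measurable => n _; apply: measurableI.
    by apply: measurableX => //; exact: measurable_size.
  suff mz : measurable_fun setT
      (fun z : seq T * T => [tuple of z.2 :: tuple_at n z.1]).
    by rewrite -[X in measurable X]setTI; apply: mz => //; exact: mE.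
  apply: measurable_cons; first exact: measurable_snd.
  exact: (measurableT_comp (@measurable_tuple_at n) measurable_fst).
have tupleK n s : size s = n -> tuple_at n s = s :> seq T.
  by move=> <-; rewrite /tuple_at /insubd insubT.
apply/seteqP; split => [[s y] /= Es|[s y] /= [n _ [[sn _]]]].
  exists (size s) => //; split => //=.
  by rewrite [X in E (y :: X)](tupleK (size s)).
by move=> /=; rewrite [X in E (y :: X)](tupleK n).
Qed.

Lemma measurable_seq1 : measurable_fun [set: T] (fun x => [:: x]).
Proof.
have mf : measurable_fun [set: T] (fun x => ([::] : seq T, x)).
  apply/measurable_fun_pairP; split.
    exact: (@measurable_cst _ _ _ _ _ ([::] : seq T)).
  exact: measurable_id.
exact: measurableT_comp measurable_cons_seq mf.
Qed.

Let measurable_preim_tnth n (i : 'I_n) A : measurable A ->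
  measurable [set t : n.-tuple T | A (tnth t i)].
Proof.
by move=> mA; rewrite -[X in measurable X]setTI; exact: (measurable_tnth i).
Qed.

Lemma measurable_paths A B : measurable A -> measurable B ->
  measurable (paths A B).
Proof.
move=> mA mB; rewrite -[_ (paths A B)]/(seq_measurable _) => -[|[|n]].
- rewrite (_ : [set t | _] = set0)//; apply/seteqP; split => // t /=.
  by rewrite tuple0 => -[x [s [y []]]].
- rewrite (_ : [set t | _] = set0)//; apply/seteqP; split => // -[[|z [|z' t]]]//.
  by move=> i /= [x [[|z' s] [y []]]].
rewrite (_ : [set t : n.+2.-tuple T | _] = [set t | A (tnth t ord0)] `&`
    ([set t | B (tnth t ord_max)] `&` \bigcap_(i in [set i : 'I_n.+2 | (0 < i < n.+1)%N])
    [set t | (~` B) (tnth t i)])).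
  apply: measurableI; first exact: measurable_preim_tnth.
  apply: measurableI; first exact: measurable_preim_tnth.
  apply: fin_bigcap_measurable => // i _; apply: measurable_preim_tnth.
  exact: measurableC.
apply/seteqP; split => [t [x [s [y [tE Ax By sB]]]]|t /= [A0 [Bm Bi]]].
  have sn : size s = n.
    by have := size_tuple t; rewrite tE /= size_rcons => -[].
  split; first by rewrite /= (tnth_nth x) tE.
  split; first by rewrite /= (tnth_nth x) tE/= nth_rcons sn ltnn eqxx.
  move=> [[//|i] /= i2] i1; rewrite /= (tnth_nth x) tE/= nth_rcons sn.
  by rewrite -ltnS i1; apply: sB; apply: mem_nth; rewrite sn.
case: t => -[//|x l] /= ti in A0 Bm Bi *.
case/lastP: l => [//|s y] in ti A0 Bm Bi *.
move: (ti); rewrite /= size_rcons !eqSS => /eqP sn.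
exists x, s, y; split => //.
  by move: Bm; rewrite (tnth_nth x)/= nth_rcons sn ltnn eqxx.
move=> z /(nthP x)[i]; rewrite sn => ni <-.
have ni2 : (i.+1 < n.+2)%N by rewrite ltnS (leq_trans ni).
move: (Bi (Ordinal ni2)) => /=; rewrite !ltnS ni => /(_ isT).
by rewrite (tnth_nth x)/= nth_rcons sn ni.
Qed.

Lemma measurable_self_avoiding : measurable [set e : T * T | e.1 = e.2] ->
  measurable (@self_avoiding d T).
Proof.
move=> mdiag; rewrite -[_ self_avoiding]/(seq_measurable _) => n.
rewrite (_ : [set t | _] = \bigcap_(ij in [set ij : 'I_n * 'I_n | ij.1 != ij.2])
    [set t : n.-tuple T | tnth t ij.1 <> tnth t ij.2]).
  apply: fin_bigcap_measurable => // ij _.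
  pose f (t : n.-tuple T) := (tnth t ij.1, tnth t ij.2).
  rewrite (_ : [set t | _] = f @^-1` (~` [set e | e.1 = e.2]))//.
  rewrite -[X in measurable X]setTI.
  suff mf : measurable_fun setT f by apply: mf => //; exact: measurableC.
  apply/measurable_fun_pairP; split; first exact: (measurable_tnth ij.1).
  exact: (measurable_tnth ij.2).
apply/seteqP; split => t /=.
  rewrite /self_avoiding/= => /tuple_uniqP ut [i j] /= ij; apply/eqP.
  by apply: contra ij => /eqP/ut ->.
move=> tij; apply/tuple_uniqP => i j tE; have [//|ij] := eqVneq i j.
by have := tij (i, j) ij.
Qed.

End sequences.

(** * Densities of edge measures *)

Section inverse.
Context (R : realType).

Lemma measurable_realV : measurable_fun [set: R] (@GRing.inv R).
Proof.
rewrite (_ : @GRing.inv R = fun x => if x == 0%R then 0%R else (x^-1)%R); last first.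
  by apply/funext => x; case: eqP => // ->; rewrite invr0.
apply: measurable_fun_if => //=.
  apply: (measurable_fun_bool true); rewrite setTI.
  rewrite (_ : _ @^-1` _ = [set 0%R]); first exact: measurable_set1.
  by apply/seteqP; split => x /= /eqP.
rewrite setTI (_ : _ @^-1` _ = [set r : R | r != 0%R]); last first.
  by apply/seteqP; split => x /=; case: eqP.
apply: open_continuous_measurable_fun => //; apply/in_setP => x /= x0.
exact: inv_continuous.
Qed.

Lemma measurable_inve : measurable_fun [set: \bar R] (@inve R).
Proof.
have mb (a : \bar R) : measurable_fun [set: \bar R] (fun x => x == a).
  by apply: measurable_fun_eqe => //; exact: measurable_cst.
have -> : @inve R = fun x => if x == 0 then +oo else if x == +oo then 0 else
    if x == -oo then -oo else ((fine x)^-1)%:E.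
  by apply/funext => -[r| |]; rewrite ?invey ?inveNy.
do 3! apply: measurable_fun_ifT => //.
apply/measurable_EFinP; apply: measurableT_comp measurable_realV _.
exact: fine_measurable.
Qed.

End inverse.

Section radon_nikodym.
Context d (T : measurableType d) (R : realType).
Implicit Types nu m : {measure set T -> \bar R}.

Let finite_density nu m : nu setT < +oo -> m setT < +oo -> nu `<< m ->
  exists f, is_density nu m f.
Proof.
move=> nuoo moo num.
pose nu' : {finite_measure set T -> \bar R} := mfrestr measurableT nuoo.
pose m' : {finite_measure set T -> \bar R} := mfrestr measurableT moo.
have nuE A : nu' A = nu A by rewrite /nu'/= /mfrestr /mrestr setIT.
have mE A : m' A = m A by rewrite /m'/= /mfrestr /mrestr setIT.
have num' : nu' `<< m'.
  apply/null_content_dominatesP => A mA mA0; apply: etrans (nuE A) _.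
  move/null_content_dominatesP : num; apply => //.
  exact: etrans (esym (mE A)) mA0.
have [f [f0 fi fE]] := radon_nikodym_finite num'.
exists f; split => //; first exact: measurable_int fi.
move=> E mE'; rewrite -nuE; apply: etrans (fE _ mE') _.
by apply: eq_measure_integral => A mA _; exact: mE.
Qed.

(** A measure that is a countable sum of finite measures need not be
    sigma-finite; its density is the sum of the densities of the terms, with
    value +oo allowed. *)
Lemma sfinite_density nu m (nu_ : nat -> {measure set T -> \bar R}) :
  m setT < +oo -> nu `<< m -> (forall n, nu_ n setT < +oo) ->
  (forall E, measurable E -> nu E = \sum_(n <oo) nu_ n E) ->
  exists f, is_density nu m f.
Proof.
move=> moo num nu_oo nuE.
have nu_m n : nu_ n `<< m.
  apply/null_content_dominatesP => A mA mA0.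
  move/null_content_dominatesP : num => /(_ A mA mA0); rewrite nuE// => s0.
  apply/eqP; rewrite eq_le measure_ge0 andbT -s0.
  rewrite (@nneseriesD1 _ _ n)//.
  by apply: leeDl; apply: nneseries_ge0 => i _ _; exact: measure_ge0.
have [f fE] := choice (fun n => finite_density (nu_oo n) moo (nu_m n)).
have mf n : measurable_fun setT (f n) by have [] := fE n.
have f0 n x : 0 <= f n x by have [] := fE n.
exists (fun x => \sum_(n <oo) f n x); split.
- exact: ge0_emeasurable_sum.
- by move=> x; exact: nneseries_ge0.
- move=> E mE; rewrite nuE// integral_nneseries//.
  + by apply: eq_eseriesr => n _; have [_ _ ->] := fE n.
  + by move=> n; exact: measurable_funTS.
Qed.

End radon_nikodym.

Lemma integral_mrestr d (T : measurableType d) (R : realType)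
    (m : {measure set T -> \bar R}) (D : set T) (mD : measurable D) f :
  measurable_fun setT f -> (forall x, 0 <= f x) ->
  \int[mrestr m mD]_x f x = \int[m]_(x in D) f x.
Proof.
apply: (@integral_functional _ _ _ (mrestr m mD) (fun f => \int[m]_(x in D) f x)).
- by move=> E mE; rewrite integral_indic.
- by move=> g g0; exact: integral_ge0.
- by move=> r g r0 mg g0; rewrite ge0_integralZl//; exact: measurable_funTS.
- by move=> g mg g0; rewrite integral_nneseries// => n; exact: measurable_funTS.
Qed.

Section edge_measure_density.
Context d (T : measurableType d) (R : realType).
Variables (P : probability (seq T) R).

(** Paths with a given number of vertices have boundedly many edges, so each
    of them contributes a finite measure even if the mean length is infinite. *)
Lemma edge_measure_density (m : {measure set (T * T) -> \bar R}) :
  m setT < +oo -> edge_measure P `<< m ->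
  is_density (edge_measure P) m (density (edge_measure P) m).
Proof.
move=> moo Pm.
suff [f fE] : exists f, is_density (edge_measure P) m f.
  exact: (xgetPex (cst 0) (ex_intro _ f fE)).
have msize n : measurable [set s : seq T | size s = n] by exact: measurable_size.
pose Q n := mrestr P (msize n).
pose ES E (g : seq T) : \bar R := edge_sum (fun e => (\1_E e)%:E) g.
have mES E : measurable E -> measurable_fun setT (ES E).
  move=> mE; apply: measurable_edge_sum.
  by apply/measurable_EFinP; exact: measurable_indic.
have ES0 E g : 0 <= ES E g.
  by apply: sume_ge0 => e _; rewrite lee_fin.
have QE n E : measurable E -> edge_measure (Q n) E =
    \int[P]_(g in [set s : seq T | size s = n]) ES E g.
  by move=> mE; rewrite /edge_measure integral_mrestr//; [exact: mES|exact: ES0].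
apply: (@sfinite_density _ _ _ _ _ (fun n => edge_measure (Q n))) => //.
- move=> n; rewrite [ltLHS](QE n _ measurableT).
  apply: (@le_lt_trans _ _ (\int[P]_(g in [set s : seq T | size s = n]) n%:R%:E)).
    apply: ge0_le_integral => //.
    + by apply: measurable_funTS; exact: mES.
    + move=> g /= gn; rewrite /ES /edge_sum (eq_bigr (fun=> 1%:E)); last first.
        by move=> e _; rewrite indicT.
      rewrite sumEFin big_const_seq iter_addr_0 lee_fin ler_nat count_predT.
      by rewrite /edges size_zip gn geq_minl.
  by rewrite integral_cst// lte_mul_pinfty// ?lee_fin//
    (le_lt_trans (probability_le1 _ _))// ltry.
- move=> E mE.
  transitivity (\int[P]_(g in \bigcup_n [set s | size s = n]) ES E g).
    suff -> : \bigcup_n [set s | size s = n] = [set: seq T] by [].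
    by apply/seteqP; split => s // _; exists (size s).
  rewrite ge0_integral_bigcup//.
  + by apply: eq_eseriesr => n _; rewrite [RHS](QE n _ mE).
  + by apply: measurable_funTS; exact: mES.
  + by move=> i j _ _ [s [/= <- <-]].
Qed.

End edge_measure_density.

(** * Random paths grown at the head *)

Section kernel_pullback.
Context d d' d'' (Z : measurableType d) (X : measurableType d')
  (Y : measurableType d'') (R : realType).
Variables (k : R.-ftker X ~> Y) (f : Z -> X).

(** The measurability proof is an argument so that the kernel structure can be
    inferred from the term. *)
Definition kpullback (mf : measurable_fun [set: Z] f) (z : Z) :
  {measure set Y -> \bar R} := k (f z).

Hypothesis mf : measurable_fun [set: Z] f.

Let measurable_kpullback (kX : R.-ker X ~> Y) U : measurable U ->
  measurable_fun [set: Z] (fun z => kX (f z) U).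
Proof. by move=> mU; exact: measurableT_comp (measurable_kernel kX U mU) mf. Qed.

HB.instance Definition _ := isKernel.Build _ _ _ _ _ (kpullback mf)
  (@measurable_kpullback k).

Let sfinite_kpullback : exists2 s : (R.-ker Z ~> Y)^nat,
    forall n, measure_fam_uub (s n) &
    forall z U, measurable U -> kpullback mf z U = kseries s z U.
Proof.
have [s s_uub kE] := sfinite_kernel_subdef k.
pose s' n : Z -> {measure set Y -> \bar R} := fun z => s n (f z).
pose H n := isKernel.Build _ _ _ _ _ (s' n) (@measurable_kpullback (s n)).
exists (fun n => HB.pack_for (R.-ker Z ~> Y) (s' n) (H n)).
  by move=> n; have [r sr] := s_uub n; exists r => z; exact: sr.
by move=> z U mU; rewrite /kpullback kE.
Qed.

HB.instance Definition _ := isSFiniteKernel_subdef.Build _ _ _ _ _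
  (kpullback mf) sfinite_kpullback.

Let finite_kpullback z : fin_num_fun (kpullback mf z).
Proof. exact: (@kernel_finite_transition _ _ _ _ _ k). Qed.

HB.instance Definition _ := isFiniteTransitionKernel.Build _ _ _ _ _
  (kpullback mf) finite_kpullback.

End kernel_pullback.

Section path_measure.
Context d (T : measurableType d) (R : realType).
Variables (mu : {measure set T -> \bar R}) (k : R.-ftker T ~> T).
Variables (p : T * T -> \bar R) (rho : T -> \bar R) (A : set T).
Hypotheses (mp : measurable_fun setT p) (p0 : forall e, 0 <= p e).
Hypotheses (mrho : measurable_fun setT rho) (rho0 : forall x, 0 <= rho x).
Hypothesis mA : measurable A.
Implicit Types F : seq T -> \bar R.

(** Sequences are extended at the head, where the current vertex is then found:
    a path grows backwards, from its last vertex to its first. *)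
Definition grow F (s : seq T) : \bar R :=
  \int[k (head point s)]_y (p (head point s, y) * F (y :: s)).

Let mintegrand F : measurable_fun setT F ->
  measurable_fun [set: seq T * T] (fun z => p (head point z.1, z.2) * F (z.2 :: z.1)).
Proof.
move=> mF; apply: emeasurable_funM; last first.
  exact: measurableT_comp mF (@measurable_cons_seq _ T).
apply: measurableT_comp mp _; apply/measurable_fun_pairP; split.
  exact: measurableT_comp (@measurable_head _ T) measurable_fst.
exact: measurable_snd.
Qed.

Let mintegrand1 F s : measurable_fun setT F ->
  measurable_fun [set: T] (fun y => p (head point s, y) * F (y :: s)).
Proof. by move=> /mintegrand mF; exact: measurableT_comp mF (measurable_pair1 s). Qed.

Lemma grow_ge0 F : (forall s, 0 <= F s) -> forall s, 0 <= grow F s.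
Proof. by move=> F0 s; apply: integral_ge0 => y _; exact: mule_ge0. Qed.

Lemma measurable_grow F : measurable_fun setT F -> (forall s, 0 <= F s) ->
  measurable_fun setT (grow F).
Proof.
move=> mF F0.
apply: (@measurable_kfcomp _ _ _ _ _ (kpullback k (@measurable_head _ T))
  (fun z => p (head point z.1, z.2) * F (z.2 :: z.1))).
  exact: mintegrand.
by move=> z; exact: mule_ge0.
Qed.

Lemma grow_series (F : (seq T -> \bar R)^nat) :
  (forall n, measurable_fun setT (F n)) -> (forall n s, 0 <= F n s) ->
  grow (fun s => \sum_(n <oo) F n s) = fun s => \sum_(n <oo) grow (F n) s.
Proof.
move=> mF F0; apply/funext => s; rewrite /grow -integral_nneseries//.
- by apply: eq_integral => y _; rewrite nneseries_Zl.
- by move=> n; exact: mintegrand1.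
- by move=> n y _; exact: mule_ge0.
Qed.

Lemma growZ (r : R) F : (0 <= r)%R -> measurable_fun setT F ->
  (forall s, 0 <= F s) -> grow (fun s => r%:E * F s) = fun s => r%:E * grow F s.
Proof.
move=> r0 mF F0; apply/funext => s; rewrite /grow -ge0_integralZl//.
- by apply: eq_integral => y _; rewrite muleCA.
- exact: mintegrand1.
- by move=> y _; exact: mule_ge0.
Qed.

Lemma le_grow F G : measurable_fun setT F -> (forall s, 0 <= F s) ->
  measurable_fun setT G -> (forall s, F s <= G s) ->
  forall s, grow F s <= grow G s.
Proof.
move=> mF F0 mG FG s; apply: ge0_le_integral => //.
- by move=> y _; exact: mule_ge0.
- exact: mintegrand1.
- exact: mintegrand1.
- by move=> y _; exact: lee_wpmul2l.
Qed.

Lemma growD F G : measurable_fun setT F -> (forall s, 0 <= F s) ->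
  measurable_fun setT G -> (forall s, 0 <= G s) ->
  grow (fun s => F s + G s) = fun s => grow F s + grow G s.
Proof.
move=> mF F0 mG G0; apply/funext => s; rewrite /grow -ge0_integralD//.
- by apply: eq_integral => y _; rewrite ge0_muleDr.
- by move=> y _; exact: mule_ge0.
- exact: mintegrand1.
- by move=> y _; exact: mule_ge0.
- exact: mintegrand1.
Qed.

Lemma iter_grow_ge0 n F : (forall s, 0 <= F s) -> forall s, 0 <= iter n grow F s.
Proof. by move=> F0; elim: n => //= n IH; exact: grow_ge0. Qed.

Lemma measurable_iter_grow n F : measurable_fun setT F -> (forall s, 0 <= F s) ->
  measurable_fun setT (iter n grow F).
Proof.
move=> mF F0; elim: n => //= n IH; apply: measurable_grow => //.
exact: iter_grow_ge0.
Qed.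

Lemma iter_grow_series n (F : (seq T -> \bar R)^nat) :
  (forall n, measurable_fun setT (F n)) -> (forall n s, 0 <= F n s) ->
  iter n grow (fun s => \sum_(i <oo) F i s) =
  fun s => \sum_(i <oo) iter n grow (F i) s.
Proof.
move=> mF F0; elim: n => //= n ->; apply: grow_series => i.
  exact: measurable_iter_grow.
exact: iter_grow_ge0.
Qed.

Lemma iter_growZ n (r : R) F : (0 <= r)%R -> measurable_fun setT F ->
  (forall s, 0 <= F s) ->
  iter n grow (fun s => r%:E * F s) = fun s => r%:E * iter n grow F s.
Proof.
move=> r0 mF F0; elim: n => //= n ->; apply: growZ => //.
  exact: measurable_iter_grow.
exact: iter_grow_ge0.
Qed.

Definition stopped F (s : seq T) : \bar R := (\1_A (head point s))%:E * F s.

Lemma stopped_ge0 F : (forall s, 0 <= F s) -> forall s, 0 <= stopped F s.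
Proof. by move=> F0 s; rewrite mule_ge0// lee_fin. Qed.

Lemma measurable_stopped F : measurable_fun setT F ->
  measurable_fun setT (stopped F).
Proof.
move=> mF; apply: emeasurable_funM => //; apply/measurable_EFinP.
exact: measurableT_comp (measurable_indic mA) (@measurable_head _ T).
Qed.

Definition path_mean n F : \bar R :=
  \int[mu]_x (rho x * iter n grow (stopped F) [:: x]).

Lemma measurable_path_mean_integrand n F : measurable_fun setT F ->
  (forall s, 0 <= F s) ->
  measurable_fun setT (fun x => rho x * iter n grow F [:: x]).
Proof.
move=> mF F0; apply: emeasurable_funM => //.
have mG := measurable_iter_grow n mF F0.
exact: measurableT_comp mG (@measurable_seq1 _ T).
Qed.

Lemma path_mean_ge0 n F : (forall s, 0 <= F s) -> 0 <= path_mean n F.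
Proof.
move=> F0; apply: integral_ge0 => x _; rewrite mule_ge0//.
by apply: iter_grow_ge0; exact: stopped_ge0.
Qed.

Definition path_functional F : \bar R := \sum_(n <oo) path_mean n F.

Lemma path_functional_ge0 F : (forall s, 0 <= F s) -> 0 <= path_functional F.
Proof. by move=> F0; apply: nneseries_ge0 => n _ _; exact: path_mean_ge0. Qed.

Lemma path_functionalZ (r : R) F : (0 <= r)%R -> measurable_fun setT F ->
  (forall s, 0 <= F s) ->
  path_functional (fun s => r%:E * F s) = r%:E * path_functional F.
Proof.
move=> r0 mF F0; rewrite /path_functional -nneseries_Zl//; last first.
  by move=> n; exact: path_mean_ge0.
apply: eq_eseriesr => n _; rewrite /path_mean -ge0_integralZl//.
- apply: eq_integral => x _.
  rewrite (_ : stopped _ = fun s => r%:E * stopped F s); last first.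
    by apply/funext => s; rewrite /stopped muleCA.
  rewrite iter_growZ//; [by rewrite muleCA|exact: measurable_stopped|].
  exact: stopped_ge0.
- apply: measurable_path_mean_integrand; first exact: measurable_stopped.
  exact: stopped_ge0.
- move=> x _; rewrite mule_ge0//; apply: iter_grow_ge0; exact: stopped_ge0.
Qed.

Lemma path_functional_series (F : (seq T -> \bar R)^nat) :
  (forall n, measurable_fun setT (F n)) -> (forall n s, 0 <= F n s) ->
  path_functional (fun s => \sum_(n <oo) F n s) = \sum_(n <oo) path_functional (F n).
Proof.
move=> mF F0; rewrite /path_functional nneseries_interchange//; last first.
  by move=> i j; exact: path_mean_ge0.
apply: eq_eseriesr => n _; rewrite /path_mean -integral_nneseries//.
- apply: eq_integral => x _.
  rewrite (_ : stopped _ = fun s => \sum_(i <oo) stopped (F i) s); last first.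
    by apply/funext => s; rewrite /stopped nneseries_Zl// lee_fin.
  rewrite iter_grow_series.
  + rewrite nneseries_Zl// => i; apply: iter_grow_ge0; exact: stopped_ge0.
  + by move=> i; exact: measurable_stopped.
  + by move=> i; exact: stopped_ge0.
- move=> i; apply: measurable_path_mean_integrand.
    exact: measurable_stopped.
  exact: stopped_ge0.
- by move=> i x _; rewrite mule_ge0//; apply: iter_grow_ge0; exact: stopped_ge0.
Qed.

Definition path_measure (E : set (seq T)) : \bar R := path_functional (EFin \o \1_E).

Let mindic (E : set (seq T)) : measurable E ->
  measurable_fun setT (EFin \o \1_E : seq T -> \bar R).
Proof. by move=> mE; apply/measurable_EFinP; exact: measurable_indic. Qed.

Let indic_ge0 (E : set (seq T)) s : 0 <= (EFin \o \1_E : seq T -> \bar R) s.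
Proof. by rewrite lee_fin. Qed.

Let path_measure0 : path_measure set0 = 0.
Proof.
rewrite /path_measure (_ : EFin \o \1_set0 = fun s => 0%:E * (EFin \o \1_set0) s).
  by rewrite path_functionalZ ?mul0e//; exact: mindic.
by apply/funext => s; rewrite /= indic0 mul0e.
Qed.

Let path_measure_ge0 E : 0 <= path_measure E.
Proof. exact: path_functional_ge0. Qed.

Let path_measure_sigma_additive : semi_sigma_additive path_measure.
Proof.
move=> F mF tF mUF; rewrite /path_measure.
rewrite (_ : EFin \o _ = fun s => \sum_(n <oo) (EFin \o \1_(F n)) s); last first.
  by apply/funext => s; rewrite /= indic_bigcup.
rewrite path_functional_series//; last by move=> n; exact: mindic.
by apply: is_cvg_nneseries => n _ _; exact: path_functional_ge0.
Qed.

HB.instance Definition _ := isMeasure.Build _ _ _ path_measure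
  path_measure0 path_measure_ge0 path_measure_sigma_additive.

(** Unlike [path_measure], this constant carries the measurability and
    positivity hypotheses on which the measure structure depends. *)
Definition path_law : {measure set (seq T) -> \bar R} := path_measure.

Lemma integral_path_law F : measurable_fun setT F -> (forall s, 0 <= F s) ->
  \int[path_law]_s F s = path_functional F.
Proof.
apply: integral_functional => //.
- exact: path_functional_ge0.
- exact: path_functionalZ.
- exact: path_functional_series.
Qed.

(** A step out of H has weight 0, so the functional only sees paths in H. *)
Lemma path_functional_support (H : set (seq T)) F :
  (forall x, rho x = 0 \/ H [:: x]) ->
  (forall s y, H s -> p (head point s, y) = 0 \/ H (y :: s)) ->
  (forall s, H s -> A (head point s) -> F s = 0) ->
  path_functional F = 0.
Proof.
move=> H1 HS HF; apply: eseries0 => n _ _; apply: integral0_eq => x _.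
have [->|Hx] := H1 x; first by rewrite mul0e.
suff -> : iter n grow (stopped F) [:: x] = 0 by rewrite mule0.
elim: n {x} [:: x] Hx => [|n IH] s Hs /=.
  rewrite /stopped indicE; have [|As] := boolP (head point s \in A).
    by rewrite inE => As; rewrite HF// mule0.
  by rewrite mul0e.
apply: integral0_eq => y _; have [->|Hy] := HS _ y Hs; first by rewrite mul0e.
by rewrite IH ?mule0.
Qed.

(** What [grow] does to functions of the current vertex alone. *)
Definition transfer (c : T -> \bar R) (x : T) : \bar R :=
  \int[k x]_y (p (x, y) * c y).

Lemma transfer_ge0 c : (forall x, 0 <= c x) -> forall x, 0 <= transfer c x.
Proof. by move=> c0 x; apply: integral_ge0 => y _; exact: mule_ge0. Qed.

Let mtransfer_integrand c : measurable_fun setT c ->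
  measurable_fun [set: T * T] (fun e => p e * c e.2).
Proof.
move=> mc; apply: emeasurable_funM => //.
exact: measurableT_comp mc measurable_snd.
Qed.

Lemma measurable_transfer c : measurable_fun setT c -> (forall x, 0 <= c x) ->
  measurable_fun setT (transfer c).
Proof.
move=> mc c0; apply: (measurable_kernel_integral k (mtransfer_integrand mc)).
by move=> e; exact: mule_ge0.
Qed.

Lemma transferD b c : measurable_fun setT b -> (forall x, 0 <= b x) ->
  measurable_fun setT c -> (forall x, 0 <= c x) ->
  transfer (fun x => b x + c x) = fun x => transfer b x + transfer c x.
Proof.
move=> mb b0 mc c0; apply/funext => x; rewrite /transfer -ge0_integralD//.
- by apply: eq_integral => y _; rewrite ge0_muleDr.
- by move=> y _; exact: mule_ge0.
- exact: measurableT_comp (mtransfer_integrand mb) (measurable_pair1 x).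
- by move=> y _; exact: mule_ge0.
- exact: measurableT_comp (mtransfer_integrand mc) (measurable_pair1 x).
Qed.

Lemma iter_transfer_ge0 n c : (forall x, 0 <= c x) ->
  forall x, 0 <= iter n transfer c x.
Proof. by move=> c0; elim: n => //= n IH; exact: transfer_ge0. Qed.

Lemma measurable_iter_transfer n c : measurable_fun setT c ->
  (forall x, 0 <= c x) -> measurable_fun setT (iter n transfer c).
Proof.
move=> mc c0; elim: n => //= n IH; apply: measurable_transfer => //.
exact: iter_transfer_ge0.
Qed.

Lemma iter_transferD n b c : measurable_fun setT b -> (forall x, 0 <= b x) ->
  measurable_fun setT c -> (forall x, 0 <= c x) ->
  iter n transfer (fun x => b x + c x) =
  fun x => iter n transfer b x + iter n transfer c x.
Proof.
move=> mb b0 mc c0; elim: n => //= n ->; apply: transferD.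
- exact: measurable_iter_transfer.
- exact: iter_transfer_ge0.
- exact: measurable_iter_transfer.
- exact: iter_transfer_ge0.
Qed.

Lemma iter_grow_head n c :
  iter n grow (c \o head point) = iter n transfer c \o head point.
Proof. by elim: n => //= n ->. Qed.

Definition start_mean (c : T -> \bar R) : \bar R := \int[mu]_x (rho x * c x).

Lemma start_mean_ge0 c : (forall x, 0 <= c x) -> 0 <= start_mean c.
Proof. by move=> c0; apply: integral_ge0 => x _; exact: mule_ge0. Qed.

Lemma start_meanD b c : measurable_fun setT b -> (forall x, 0 <= b x) ->
  measurable_fun setT c -> (forall x, 0 <= c x) ->
  start_mean (fun x => b x + c x) = start_mean b + start_mean c.
Proof.
move=> mb b0 mc c0; rewrite /start_mean -ge0_integralD//.
- by apply: eq_integral => x _; rewrite ge0_muleDr.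
- by move=> x _; exact: mule_ge0.
- exact: emeasurable_funM.
- by move=> x _; exact: mule_ge0.
- exact: emeasurable_funM.
Qed.

(** The excessive density eta dominates the density of the expected number of
    visits of the chain started from rho, whether or not the integrals are
    finite. *)
Lemma green_bound (eta c : T -> \bar R) n :
  (forall c, measurable_fun setT c -> (forall x, 0 <= c x) ->
     start_mean c + \int[mu]_x (eta x * transfer c x) <= \int[mu]_x (eta x * c x)) ->
  measurable_fun setT c -> (forall x, 0 <= c x) -> (forall x, 0 <= eta x) ->
  \sum_(i < n) start_mean (iter i transfer c) <= \int[mu]_x (eta x * c x).
Proof.
move=> excessive + + eta0; elim: n c => [|n IH] c mc c0.
  by rewrite big_ord0 integral_ge0// => x _; exact: mule_ge0.
apply: le_trans (excessive _ mc c0); rewrite big_ord_recl/= leeD2l//.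
under eq_bigr do rewrite -iterS iterSr.
apply: IH; first exact: measurable_transfer.
exact: transfer_ge0.
Qed.

End path_measure.

(** If the remainders of a series with sum at most 1 are summable, then they
    tend to 0, and the sum is 1. *)
Lemma nneseries_eq1 (R : realType) (u a : (\bar R)^nat) (M : \bar R) :
  (forall n, 0 <= u n) -> (forall n, 0 <= a n) -> M < +oo ->
  (forall n, \sum_(i < n) u i + a n = 1) ->
  (forall n, \sum_(i < n) a i <= M) ->
  \sum_(n <oo) u n = 1.
Proof.
move=> u0 a0 Moo ua a_sum; set L := \sum_(n <oo) _.
have L1 : L <= 1.
  apply: lime_le; first exact: is_cvg_nneseries.
  by apply: nearW => n; rewrite big_mkord -(ua n) leeDl.
have L0 : 0 <= L by exact: nneseries_ge0.
have La n : 1 <= L + a n.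
  rewrite -(ua n) leeD2r//.
  by rewrite -(big_mkord xpredT u); exact: nneseries_lim_ge.
apply/eqP; rewrite eq_le L1/= leNgt; apply/negP => Llt1.
have M0 : 0 <= M by have := a_sum 0%N; rewrite big_ord0.
move: L L1 L0 La Llt1 => [L| |]// _ _ La; rewrite lte_fin -subr_gt0 => dlt.
move: M M0 Moo a_sum => [M| |]// M0 _ a_sum.
have /= := archi_boundP (normr_ge0 (M / (1 - L))%R); set N := Num.bound _ => MN.
suff : (N%:R * (1 - L) <= M)%R.
  rewrite leNgt => /negP; apply.
  rewrite -ltr_pdivrMr//; apply: le_lt_trans MN.
  by rewrite (le_trans (ler_norm _))// normr_id.
rewrite -lee_fin; apply: le_trans (a_sum N).
rewrite mulr_natl -[X in (_ *+ X)%R](card_ord N) -sumr_const -sumEFin.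
apply: lee_sum => i _; rewrite EFinB leeBlDr// addrC; exact: La.
Qed.

Section path_law.
Context d (T : measurableType d) (R : realType).
Variables (mu : {measure set T -> \bar R}) (k : R.-ftker T ~> T).
Variables (p : T * T -> \bar R) (rho eta : T -> \bar R) (A : set T).
Hypotheses (mp : measurable_fun setT p) (p0 : forall e, 0 <= p e).
Hypotheses (mrho : measurable_fun setT rho) (rho0 : forall x, 0 <= rho x).
Hypothesis eta0 : forall x, 0 <= eta x.
Hypothesis mA : measurable A.
Hypothesis eta_excessive : forall c : T -> \bar R,
  measurable_fun setT c -> (forall x, 0 <= c x) ->
  start_mean mu rho c + \int[mu]_x (eta x * transfer k p c x) <=
  \int[mu]_x (eta x * c x).

Local Notation Tr := (transfer k p).
Local Notation gr := (grow k p).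
Local Notation mean := (start_mean mu rho).

Let miter F n : measurable_fun setT F -> (forall s : seq T, 0 <= F s) ->
  measurable_fun setT (iter n gr F).
Proof. exact: measurable_iter_grow. Qed.

Section mass.
Hypothesis rho1 : mean (cst 1) = 1.
Hypothesis eta_fin : \int[mu]_x eta x < +oo.
Variable dead : set T.
Hypothesis mdead : measurable dead.
Hypothesis trichotomy : forall x,
  (\1_A x)%:E + (\1_dead x)%:E + Tr (cst 1) x = 1.
Hypothesis eta_dead : \int[mu]_x (eta x * (\1_dead x)%:E) = 0.

Let m1 E : measurable E -> measurable_fun [set: T] (fun x => (\1_E x)%:E : \bar R).
Proof. by move=> mE; apply/measurable_EFinP; exact: measurable_indic. Qed.

(** The expected number of steps is at most the mass of eta, hence finite, so
    almost every path stops; and none of them stops outside A, because eta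
    does not charge the dead ends. *)
Lemma path_functional1 : path_functional mu k p rho A (cst 1) = 1.
Proof.
pose S n := \sum_(i < n) mean (iter i Tr (fun x => (\1_A x)%:E)).
pose a n := mean (iter n Tr (cst 1)).
have ge1 E (x : T) : 0 <= (\1_E x)%:E :> \bar R by rewrite lee_fin.
have mTr n c : measurable_fun setT c -> (forall x, 0 <= c x) ->
  measurable_fun setT (iter n Tr c) by exact: measurable_iter_transfer.
have Tr0 n c : (forall x, 0 <= c x) -> forall x, 0 <= iter n Tr c x.
  exact: iter_transfer_ge0.
have dead0 n : mean (iter n Tr (fun x => (\1_dead x)%:E)) = 0.
  apply/eqP; rewrite eq_le start_mean_ge0// ?andbT//; last exact: Tr0.
  have := @green_bound _ _ _ mu k p rho mp p0 eta _ n.+1 eta_excessive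
    (m1 mdead) (ge1 dead) eta0.
  rewrite eta_dead big_ord_recr/=; apply: le_trans.
  apply: leeDr; apply: sume_ge0 => i _; apply: start_mean_ge0 => //; exact: Tr0.
have aS n : a n = mean (iter n Tr (fun x => (\1_A x)%:E)) + a n.+1.
  have -> : a n = mean (iter n Tr
      (fun x => ((\1_A x)%:E + (\1_dead x)%:E) + Tr (cst 1) x)).
    by congr (mean (iter n Tr _)); apply/funext => x; rewrite trichotomy.
  have mT1 : measurable_fun setT (Tr (cst 1)) by exact: measurable_transfer.
  have T10 x : 0 <= Tr (cst 1) x by exact: transfer_ge0.
  have mAd : measurable_fun setT (fun x => (\1_A x)%:E + (\1_dead x)%:E : \bar R).
    by apply: emeasurable_funD; exact: m1.
  have Ad0 x : 0 <= (\1_A x)%:E + (\1_dead x)%:E :> \bar R by exact: adde_ge0.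
  rewrite iter_transferD// start_meanD//; last 4 first.
  - exact: mTr.
  - exact: Tr0.
  - exact: mTr.
  - exact: Tr0.
  rewrite iter_transferD//; [|exact: m1|exact: m1].
  rewrite start_meanD//; last 4 first.
  - by apply: mTr => //; exact: m1.
  - exact: Tr0.
  - by apply: mTr => //; exact: m1.
  - exact: Tr0.
  by rewrite dead0 adde0 /a iterSr.
have Sa n : S n + a n = 1.
  elim: n => [|n IH]; first by rewrite /S big_ord0 add0e.
  by rewrite -IH /S big_ord_recr/= -addeA -aS.
have path1E : path_functional mu k p rho A (cst 1) =
    \sum_(n <oo) mean (iter n Tr (fun x => (\1_A x)%:E)).
  apply: eq_eseriesr => n _; apply: eq_integral => x _; congr (_ * _).
  rewrite (_ : stopped A (cst 1) = (fun x => (\1_A x)%:E) \o head point).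
    by rewrite iter_grow_head.
  by apply/funext => s; rewrite /stopped mule1.
rewrite path1E; apply: (@nneseries_eq1 _ _ a (\int[mu]_x eta x)).
- by move=> n; apply: start_mean_ge0; [exact: rho0|exact: Tr0].
- by move=> n; apply: start_mean_ge0; [exact: rho0|exact: Tr0].
- exact: eta_fin.
- exact: Sa.
- move=> n; have := @green_bound _ _ _ mu k p rho mp p0 eta (cst 1) n eta_excessive.
  rewrite (_ : \int[mu]_x _ = \int[mu]_x eta x); last first.
    by apply: eq_integral => x _; rewrite mule1.
  by apply; [exact: measurable_cst|move=> x; exact: lee01|exact: eta0].
Qed.

End mass.

Variable f : T * T -> \bar R.
Hypotheses (mf : measurable_fun setT f) (f0 : forall e, 0 <= f e).
Hypothesis subprob : forall x, (\1_A x)%:E + Tr (cst 1) x <= 1.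

(** Growing a path by one edge raises its edge sum by the weight of that edge,
    so the mean edge sum is at most the mean of the accumulated one-step
    contributions, which are bounded through eta. *)
Lemma path_functional_edge_sum :
  path_functional mu k p rho A (edge_sum f) <=
  \int[mu]_x (eta x * \int[k x]_y (p (x, y) * f (y, x))).
Proof.
pose c x := \int[k x]_y (p (x, y) * f (y, x)).
have mswapf : measurable_fun setT (fun e : T * T => f (e.2, e.1)).
  exact: measurableT_comp mf (@measurable_swap _ T).
have mpf : measurable_fun setT (fun e : T * T => p e * f (e.2, e.1)).
  exact: emeasurable_funM.
have mc : measurable_fun setT c.
  by apply: (measurable_kernel_integral k mpf) => e; exact: mule_ge0.
have c0 x : 0 <= c x by apply: integral_ge0 => y _; exact: mule_ge0.
have mES : measurable_fun setT (edge_sum f) by exact: measurable_edge_sum.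
have ES0 s : 0 <= edge_sum f s by apply: sume_ge0.
have mh b : measurable_fun setT b -> measurable_fun setT (b \o head point : seq T -> \bar R).
  by move=> mb; exact: measurableT_comp mb (@measurable_head _ T).
pose U n (F : seq T -> \bar R) s := \sum_(i < n) iter i gr F s.
have U0 n F : (forall s, 0 <= F s) -> forall s, 0 <= U n F s.
  by move=> F0 s; apply: sume_ge0 => i _; exact: iter_grow_ge0.
have mU n F : measurable_fun setT F -> (forall s, 0 <= F s) ->
    measurable_fun setT (U n F).
  by move=> mF F0; apply: emeasurable_sum => i; exact: miter.
have US n F s : measurable_fun setT F -> (forall s, 0 <= F s) ->
    U n.+1 F s = F s + gr (U n F) s.
  move=> mF F0; rewrite /U big_ord_recl/=; congr (_ + _).
  suff -> : gr (U n F) = fun s => \sum_(i < n) gr (iter i gr F) s by [].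
  elim: n {s} => [|n IH].
    apply/funext => s; rewrite big_ord0; apply: integral0_eq => y _.
    by rewrite /U big_ord0 mule0.
  rewrite (_ : U n.+1 F = fun s => U n F s + iter n gr F s); last first.
    by apply/funext => s; rewrite /U big_ord_recr.
  rewrite growD//; [|exact: mU|exact: U0|exact: miter|exact: iter_grow_ge0].
  by rewrite IH; apply/funext => s; rewrite big_ord_recr.
pose ch : seq T -> \bar R := c \o head point.
have grES s : gr (edge_sum f) s <=
    ch s + edge_sum f s * Tr (cst 1) (head point s).
  have mE : measurable_fun setT (fun y => p (head point s, y) * f (y, head point s)).
    exact: measurableT_comp mpf (measurable_pair1 (head point s)).
  have mp1 : measurable_fun setT (fun y => p (head point s, y)).
    exact: measurableT_comp mp (measurable_pair1 (head point s)).
  apply: (@le_trans _ _ (\int[k (head point s)]_y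
      (p (head point s, y) * f (y, head point s) +
       edge_sum f s * p (head point s, y)))).
    apply: ge0_le_integral => //.
    - by move=> y _; rewrite mule_ge0.
    - apply: emeasurable_funM => //.
      apply: measurableT_comp mES _.
      exact: measurableT_comp (@measurable_cons_seq _ T) (measurable_pair1 s).
    - by apply: emeasurable_funD => //; exact: measurable_funeM.
    - move=> y _; rewrite [edge_sum f s * _]muleC -ge0_muleDr//; apply: lee_wpmul2l => //.
      case: s {mE mp1} => [|x s]; rewrite /edge_sum /edges/=.
        by rewrite !big_nil adde0.
      by rewrite big_cons.
  rewrite ge0_integralD//; last 2 first.
  - by move=> y _; rewrite mule_ge0.
  - exact: measurable_funeM.
  - apply: leeD2l; rewrite ge0_integralZl//; apply: lee_wpmul2l => //.
    by rewrite /transfer; under [leRHS]eq_integral do rewrite mule1.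
  - by move=> y _; rewrite mule_ge0.
(* the masses of stopping in A and of going on add up to at most 1, so the edge
   sum of s is counted at most once *)
have UES n s : U n (stopped A (edge_sum f)) s <= edge_sum f s + U n ch s.
  elim: n s => [|n IH] s; first by rewrite /U !big_ord0 adde0.
  have mch : measurable_fun setT ch by exact: mh.
  have ch0 r : 0 <= ch r by exact: c0.
  rewrite US; [|exact: measurable_stopped|exact: stopped_ge0].
  rewrite US//.
  have : gr (U n (stopped A (edge_sum f))) s <= gr (edge_sum f) s + gr (U n ch) s.
    rewrite (_ : gr _ s + _ = gr (fun r => edge_sum f r + U n ch r) s); last first.
      by rewrite growD//; [exact: mU|exact: U0].
    apply: le_grow => //; [|by apply: U0; exact: stopped_ge0|].
      by apply: mU; [exact: measurable_stopped|exact: stopped_ge0].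
    by apply: emeasurable_funD => //; exact: mU.
  move=> /(leeD2l (stopped A (edge_sum f) s)) /le_trans; apply.
  rewrite [leRHS]addeA addeA; apply: leeD2r.
  apply: (@le_trans _ _ (stopped A (edge_sum f) s +
    (ch s + edge_sum f s * Tr (cst 1) (head point s)))); first exact: leeD2l.
  rewrite addeCA addeC; apply: leeD2r.
  rewrite /stopped muleC -ge0_muleDr ?lee_fin//; last exact: transfer_ge0.
  by rewrite -[leRHS]mule1; exact: lee_wpmul2l.
have bound n : \sum_(i < n) path_mean mu k p rho A i (edge_sum f) <=
    \int[mu]_x (eta x * c x).
  apply: le_trans (@green_bound _ _ _ mu k p rho mp p0 eta c n eta_excessive mc c0 eta0).
  rewrite /path_mean /start_mean -!ge0_integral_sum//; last 4 first.
  - by move=> i; apply: emeasurable_funM => //; exact: measurable_iter_transfer.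
  - by move=> i x _; rewrite mule_ge0//; exact: iter_transfer_ge0.
  - move=> i; apply: measurable_path_mean_integrand => //.
      exact: measurable_stopped.
    exact: stopped_ge0.
  - by move=> i x _; rewrite mule_ge0//; apply: iter_grow_ge0 => //; exact: stopped_ge0.
  apply: ge0_le_integral => //.
  - move=> x _; apply: sume_ge0 => i _; rewrite mule_ge0//.
    by apply: iter_grow_ge0 => //; exact: stopped_ge0.
  - apply: emeasurable_sum => i; apply: measurable_path_mean_integrand => //.
      exact: measurable_stopped.
    exact: stopped_ge0.
  - apply: emeasurable_sum => i; apply: emeasurable_funM => //.
    exact: measurable_iter_transfer.
  - move=> x _; rewrite -!ge0_sume_distrr; last 2 first.
    + by move=> i _; exact: iter_transfer_ge0.
    + by move=> i _; apply: iter_grow_ge0 => //; exact: stopped_ge0.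
    apply: lee_wpmul2l => //; apply: le_trans (UES n [:: x]) _.
    rewrite /edge_sum /edges/= big_nil add0e /U.
    by apply: lee_sum => i _; rewrite iter_grow_head.
apply: lime_le; first by apply: is_cvg_nneseries => n _ _; exact: path_mean_ge0.
by apply: nearW => n; rewrite big_mkord.
Qed.

End path_law.

(** * Energy of a harmonic potential *)

(** The quotient b^2 / a lies above its tangents 2 t b - t^2 a. Unlike the
    quotient they are linear, and with the conventions 0^-1 = +oo and
    0 * +oo = 0 the bound holds for all a in [0, +oo]. *)
Lemma sqr_div_tangent (R : realType) (a : \bar R) (b t : R) :
  0 <= a -> (0 <= b)%R -> (0 <= t)%R ->
  (2 * t * b)%:E <= (b * b)%:E * a^-1 + (t * t)%:E * a.
Proof.
move=> a0 b0 t0; case: a a0 => [a| |]//; last first.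
  rewrite invey mule0 add0e => _; have [->|tn0] := eqVneq t 0%R.
    by rewrite !mulr0 !mul0r mul0e.
  by rewrite gt0_muley ?leey// lte_fin mulr_gt0// lt_def tn0.
rewrite lee_fin le_eqVlt => /predU1P[<-|a0].
  rewrite inve0 mule0 adde0; have [->|bn0] := eqVneq b 0%R.
    by rewrite !mulr0 mul0e.
  by rewrite gt0_muley ?leey// lte_fin mulr_gt0// lt_def bn0.
rewrite inver (gt_eqF a0) -!EFinM -EFinD lee_fin -subr_ge0.
rewrite (_ : _ - _ = (b - t * a) ^+ 2 / a)%R.
  by rewrite divr_ge0 ?sqr_ge0 ?ltW.
by field; rewrite gt_eqF.
Qed.

(** Cauchy-Schwarz for quotients: sum the tangent inequalities with the slope
    1 / sum a. *)
Lemma inve_sum_le (R : realType) (J : Type) (s : seq J) (a : J -> \bar R)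
    (b : J -> R) : (forall j, 0 <= a j) -> (forall j, 0 <= b j)%R ->
  1 <= \sum_(j <- s) (b j)%:E ->
  (\sum_(j <- s) a j)^-1 <= \sum_(j <- s) (b j * b j)%:E * (a j)^-1.
Proof.
move=> a0 b0 b1; set X := \sum_(j <- s) (b j * b j)%:E * _.
have tangent t : (0 <= t)%R ->
    (2 * t)%:E <= X + (t * t)%:E * \sum_(j <- s) a j.
  move=> t0; apply: (@le_trans _ _ (\sum_(j <- s) (2 * t * b j)%:E)).
    rewrite (eq_bigr (fun j => (2 * t)%:E * (b j)%:E)); last by [].
    rewrite -ge0_sume_distrr; last by move=> j _; rewrite lee_fin.
    by rewrite -[leLHS]mule1; apply: lee_wpmul2l => //; rewrite lee_fin mulr_ge0.
  rewrite ge0_sume_distrr// /X -big_split/=; apply: lee_sum => j _.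
  exact: sqr_div_tangent.
have X0 : 0 <= X.
  by apply: sume_ge0 => j _; rewrite mule_ge0 ?inve_ge0// lee_fin mulr_ge0.
have S0 : 0 <= \sum_(j <- s) a j by exact: sume_ge0.
move: (\sum_(j <- s) a j) S0 tangent => [r| |]// S0 tangent.
move: S0; rewrite lee_fin le_eqVlt => /predU1P[r0|r0].
  rewrite -r0 inve0 leye_eq; apply/eqP/eqyP => t t0.
  have := tangent (t / 2)%R (divr_ge0 (ltW t0) (ler0n _ _)).
  by rewrite -r0 mule0 adde0 mulrC divfK.
have := tangent r^-1%R; rewrite invr_ge0 (ltW r0) => /(_ isT).
rewrite inver gt_eqF// -EFinM mulrVK ?unitfE ?gt_eqF//.
by rewrite -leeBlDr// -EFinB mulr2n mulrDl !mul1r addrK.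
Qed.

Section potential.
Context d (T : measurableType d) (R : realType).
Variables (h : T -> R).
Hypotheses (mh : measurable_fun setT h).

Definition potential_drop (e : T * T) : R := Num.max (h e.1 - h e.2)%R 0%R.
Local Notation drop := potential_drop.

Lemma potential_drop_ge0 e : (0 <= drop e)%R.
Proof. by rewrite /potential_drop le_max lexx orbT. Qed.

Lemma measurable_potential_drop :
  measurable_fun setT (EFin \o potential_drop : T * T -> \bar R).
Proof.
apply/measurable_EFinP; apply: measurable_maxr => //; apply: measurable_funB.
  exact: measurableT_comp mh measurable_fst.
exact: measurableT_comp mh measurable_snd.
Qed.

Lemma edge_sum_potential_drop x (s : seq T) :
  (h x - h (last x s))%:E <= edge_sum (EFin \o drop) (x :: s) :> \bar R.
Proof.
elim: s x => [|y s IH] x; first by rewrite subrr /edge_sum /edges/= big_nil.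
rewrite /edge_sum /edges/= big_cons -/(edge_sum (EFin \o drop) (y :: s)).
apply: le_trans (leeD2l _ (IH y)); rewrite -EFinD lee_fin.
by rewrite -[leLHS](subrKA (h y)) lerD2r le_max lexx.
Qed.

End potential.

Section energy.
Context d (T : measurableType d) (R : realType).
Variables (mu : {measure set T -> \bar R}) (k : R.-ftker T ~> T).
Hypothesis rev : reversible mu k.
Hypothesis K_finite : joint mu k setT < +oo.
Local Notation K := (joint mu k).

Definition outflow (h : T -> R) (x : T) : \bar R :=
  \int[k x]_y (potential_drop h (x, y))%:E.

Definition inflow (h : T -> R) (x : T) : \bar R :=
  \int[k x]_y (potential_drop h (y, x))%:E.

Definition energy (h : T -> R) : \bar R :=
  \int[K]_e (potential_drop h e * potential_drop h e)%:E.

Section flow.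
Variables (h : T -> R) (mh : measurable_fun setT h).
Hypothesis h01 : forall x, (0 <= h x <= 1)%R.
Local Notation drop := (potential_drop h).

Let mdrop : measurable_fun setT (EFin \o drop : T * T -> \bar R).
Proof. exact: measurable_potential_drop. Qed.

Let drop0 e : 0 <= (drop e)%:E.
Proof. by rewrite lee_fin potential_drop_ge0. Qed.

Let mdropV : measurable_fun setT (fun e => (drop (e.2, e.1))%:E : \bar R).
Proof. exact: measurableT_comp mdrop (@measurable_swap _ T). Qed.

Lemma potential_drop_le1 e : (drop e <= 1)%R.
Proof.
rewrite /potential_drop ge_max ler01 andbT lerBlDr.
have /andP[_ h1] := h01 e.1; have /andP[h0 _] := h01 e.2.
by rewrite (le_trans h1)// lerDl.
Qed.

Lemma outflow_ge0 x : 0 <= outflow h x.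
Proof. exact: integral_ge0. Qed.

Lemma inflow_ge0 x : 0 <= inflow h x.
Proof. exact: integral_ge0. Qed.

Lemma measurable_outflow : measurable_fun setT (outflow h).
Proof. exact: (measurable_kernel_integral k mdrop). Qed.

Lemma measurable_inflow : measurable_fun setT (inflow h).
Proof. exact: (measurable_kernel_integral k mdropV). Qed.

Lemma integral_outflow c : measurable_fun setT c -> (forall x, 0 <= c x) ->
  \int[mu]_x (outflow h x * c x) = \int[K]_e ((drop e)%:E * c e.1).
Proof.
move=> mc c0; rewrite integral_joint//.
- apply: eq_integral => x _ /=; rewrite muleC -ge0_integralZl//.
  + by apply: eq_integral => y _; rewrite muleC.
  + exact: measurableT_comp mdrop (measurable_pair1 x).
- apply: emeasurable_funM => //.
  exact: measurableT_comp mc measurable_fst.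
- by move=> e; exact: mule_ge0.
Qed.

Lemma integral_inflow c : measurable_fun setT c -> (forall x, 0 <= c x) ->
  \int[mu]_x (inflow h x * c x) = \int[K]_e ((drop e)%:E * c e.2).
Proof.
move=> mc c0; rewrite integral_joint_swap//.
- rewrite integral_joint//.
  + apply: eq_integral => x _ /=; rewrite muleC -ge0_integralZl//.
    * by apply: eq_integral => y _; rewrite muleC.
    * exact: measurableT_comp mdropV (measurable_pair1 x).
  + apply: emeasurable_funM => //.
    exact: measurableT_comp mc measurable_fst.
  + by move=> e; exact: mule_ge0.
- apply: emeasurable_funM => //.
  exact: measurableT_comp mc measurable_snd.
- by move=> e; exact: mule_ge0.
Qed.

Lemma integral_potential_drop_fin c : measurable_fun setT c ->
  (forall e, 0 <= c e <= 1) -> \int[K]_e ((drop e)%:E * c e) < +oo.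
Proof.
move=> mc c01; apply: le_lt_trans K_finite.
have c0 e : 0 <= c e by have /andP[] := c01 e.
rewrite -[leRHS]mul1e -(integral_cst K)//; apply: ge0_le_integral => //.
- by move=> e _; exact: mule_ge0.
- exact: emeasurable_funM.
- move=> e _; rewrite -[1]mule1; apply: lee_pmul => //.
    by rewrite lee_fin potential_drop_le1.
  by have /andP[] := c01 e.
Qed.

Lemma energy_fin : energy h < +oo.
Proof.
apply: (integral_potential_drop_fin mdrop) => e.
by rewrite drop0/= lee_fin potential_drop_le1.
Qed.

Variables (A B : set T).
Hypothesis mA : measurable A.
Hypotheses (hA : forall x, A x -> h x = 1%R) (hB : forall x, B x -> h x = 0%R).
Hypothesis harmonic :
  {ae mu, forall x, ~ A x -> ~ B x -> outflow h x = inflow h x}.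

Lemma inflow_source x : A x -> inflow h x = 0.
Proof.
move=> Ax; apply: integral0_eq => y _; rewrite /potential_drop/= (hA Ax).
by rewrite max_r// subr_le0; have /andP[] := h01 y.
Qed.

Lemma outflow_sink x : B x -> outflow h x = 0.
Proof.
move=> Bx; apply: integral0_eq => y _; rewrite /potential_drop/= (hB Bx).
by rewrite max_r// subr_le0; have /andP[] := h01 y.
Qed.

(** Summation by parts: by reversibility, the energy is the difference of the
    integrals of h against the outflow and the inflow, which agree except on
    the source, where h is 1 and there is no inflow. *)
Lemma energy_outflow : energy h = \int[mu]_(x in A) outflow h x.
Proof.
pose H x : \bar R := (h x)%:E.
have mH : measurable_fun setT H by exact/measurable_EFinP.
have H0 x : 0 <= H x by rewrite lee_fin; have /andP[] := h01 x.
have H1 x : H x <= 1 by rewrite lee_fin; have /andP[] := h01 x.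
have parts : energy h + \int[mu]_x (inflow h x * H x) =
    \int[mu]_x (outflow h x * H x).
  rewrite integral_inflow// integral_outflow// /energy -ge0_integralD//.
  - apply: eq_integral => e _; rewrite /H -!EFinM -EFinD; congr (_%:E).
    rewrite -mulrDr /potential_drop; case: (leP (h e.1 - h e.2) 0)%R => _.
      by rewrite !mul0r.
    by rewrite subrK.
  - by move=> e _; rewrite EFinM mule_ge0.
  - exact: (emeasurable_funM mdrop mdrop).
  - by move=> e _; exact: mule_ge0.
  - apply: emeasurable_funM => //.
    exact: measurableT_comp mH measurable_snd.
have H_fin : \int[mu]_x (inflow h x * H x) \is a fin_num.
  rewrite ge0_fin_numE; last first.
    by apply: integral_ge0 => x _; rewrite mule_ge0// inflow_ge0.
  rewrite integral_inflow//; apply: integral_potential_drop_fin.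
    exact: measurableT_comp mH measurable_snd.
  by move=> e; rewrite H0 H1.
have balance : \int[mu]_x (outflow h x * H x) =
    \int[mu]_x (inflow h x * H x) + \int[mu]_(x in A) outflow h x.
  rewrite [X in _ + X]integral_mkcond -ge0_integralD//; last 4 first.
  - by move=> x _; rewrite mule_ge0// inflow_ge0.
  - by apply: emeasurable_funM => //; exact: measurable_inflow.
  - by move=> x _; apply: erestrict_ge0 => y _; exact: outflow_ge0.
  - apply/(measurable_restrictT _ mA); apply: measurable_funTS.
    exact: measurable_outflow.
  apply: ge0_ae_eq_integral => //.
  - by apply: emeasurable_funM => //; exact: measurable_outflow.
  - apply: emeasurable_funD.
      by apply: emeasurable_funM => //; exact: measurable_inflow.
    apply/(measurable_restrictT _ mA); apply: measurable_funTS.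
    exact: measurable_outflow.
  - by move=> x _; rewrite mule_ge0// outflow_ge0.
  - move=> x _; rewrite adde_ge0 ?mule_ge0 ?inflow_ge0//.
    by apply: erestrict_ge0 => y _; exact: outflow_ge0.
  - apply: filterS harmonic => x hx _; rewrite patchE.
    have [|xA] := boolP (x \in A).
      by rewrite inE => Ax; rewrite inflow_source// mul0e add0e /H hA// mule1.
    rewrite adde0; have [Bx|Bx] := pselect (B x).
      by rewrite /H hB// !mule0.
    by rewrite hx//; move: xA; rewrite notin_setE.
by rewrite -(addeK (energy h) H_fin) parts balance addeAC subee// add0e.
Qed.

End flow.

Lemma potential_drop_compl (h : T -> R) x y :
  potential_drop (fun x => 1 - h x)%R (x, y) = potential_drop h (y, x).
Proof. by rewrite /potential_drop/= opprB addrC subrKA. Qed.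

(** Passing to 1 - h reverses the flow and exchanges A and B. *)
Lemma energy_inflow (h : T -> R) (A B : set T) : measurable_fun setT h ->
  (forall x, 0 <= h x <= 1)%R -> measurable B ->
  (forall x, A x -> h x = 1%R) -> (forall x, B x -> h x = 0%R) ->
  {ae mu, forall x, ~ A x -> ~ B x -> outflow h x = inflow h x} ->
  energy h = \int[mu]_(x in B) inflow h x.
Proof.
move=> mh h01 mB hA hB harmonic; pose h' x := (1 - h x)%R.
have outE x : outflow h' x = inflow h x.
  by apply: eq_integral => y _; rewrite potential_drop_compl.
have inE x : inflow h' x = outflow h x.
  by apply: eq_integral => y _; rewrite potential_drop_compl.
have mh' : measurable_fun setT h' by exact: measurable_funB.
have mdrop2 : measurable_fun setT (fun e => (potential_drop h e * potential_drop h e)%:E : \bar R).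
  by apply: (emeasurable_funM (measurable_potential_drop mh) (measurable_potential_drop mh)).
transitivity (energy h').
  rewrite /energy integral_joint_swap//.
  - by apply: eq_integral => -[x y] _; rewrite potential_drop_compl.
  - by move=> e; rewrite EFinM mule_ge0 ?lee_fin ?potential_drop_ge0.
have h'01 x : (0 <= h' x <= 1)%R.
  by rewrite /h' subr_ge0 lerBlDr lerDl andbC; exact: h01.
have h'B x : B x -> h' x = 1%R by move=> Bx; rewrite /h' hB// subr0.
have h'A x : A x -> h' x = 0%R by move=> Ax; rewrite /h' hA// subrr.
have harmonic' : {ae mu, forall x, ~ B x -> ~ A x -> outflow h' x = inflow h' x}.
  by apply: filterS harmonic => x hx Bx Ax; rewrite outE inE hx.
rewrite (energy_outflow mh' h'01 mB h'B h'A harmonic').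
by apply: eq_integral => x _; exact: outE.
Qed.

(** Cauchy-Schwarz along each path: the potential drops by 1 from A to B, so
    the drops along the path sum up to at least 1. Where the density f vanishes
    or is infinite, f / f is 0, which is still at most 1. *)
Lemma inverse_density_mean_le (h : T -> R) (A B : set T) (P : probability (seq T) R) :
  measurable_fun setT h -> measurable A -> measurable B ->
  (forall x, A x -> h x = 1%R) -> (forall x, B x -> h x = 0%R) ->
  path_laws K A B P -> inverse_density_mean K P <= energy h.
Proof.
move=> mh mA mB hA hB [PAB PK _].
have fP := edge_measure_density K_finite PK; set f := density _ _ in fP.
have [mf f0 _] := fP.
pose q e : \bar R := (potential_drop h e * potential_drop h e)%:E.
have q0 e : 0 <= q e by rewrite /q EFinM mule_ge0 ?lee_fin ?potential_drop_ge0.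
have mq : measurable_fun setT q.
  exact: (emeasurable_funM (measurable_potential_drop mh) (measurable_potential_drop mh)).
have mfV : measurable_fun setT (fun e => (f e)^-1).
  exact: measurableT_comp (@measurable_inve R) mf.
have qf0 e : 0 <= q e * (f e)^-1 by rewrite mule_ge0// inve_ge0.
have mqf : measurable_fun setT (fun e => q e * (f e)^-1) by exact: emeasurable_funM.
apply: (@le_trans _ _ (\int[P]_g edge_sum (fun e => q e * (f e)^-1) g)).
  apply: ae_ge0_le_integral => //.
  - by move=> g _; rewrite inve_ge0; apply: sume_ge0 => e _; exact: f0.
  - by apply: measurableT_comp (@measurable_inve R) _; exact: measurable_edge_sum.
  - by move=> g _; apply: sume_ge0 => e _; exact: qf0.
  - exact: measurable_edge_sum.
  - have P0 : P (~` paths A B) = 0.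
      by rewrite probability_setC; [rewrite PAB subee|exact: measurable_paths].
    exists (~` paths A B); split => //.
      by apply: measurableC; exact: measurable_paths.
    apply: subsetC => g [x [s [y [-> Ax By _]]]] _.
    apply: inve_sum_le => //; first by move=> e; exact: potential_drop_ge0.
    apply: le_trans (edge_sum_potential_drop _ _ _).
    by rewrite last_rcons hA// hB// subr0.
rewrite -integral_edge_measure// (integral_is_density fP)//.
apply: ge0_le_integral => //.
- by move=> e _; rewrite mule_ge0.
- exact: emeasurable_funM.
- move=> e _; rewrite muleCA -[leRHS]mule1; apply: lee_wpmul2l => //.
  case: (f e) (f0 e) => [r| |]//; last by rewrite invey mule0.
  rewrite lee_fin le_eqVlt => /predU1P[<-|r0]; first by rewrite mul0e.
  by rewrite inver gt_eqF// -EFinM mulfV// gt_eqF.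
Qed.

End energy.

(** * The optimal path law *)

Section optimal.
Context d (T : measurableType d) (R : realType).
Variables (mu : {measure set T -> \bar R}) (k : R.-ftker T ~> T).
Hypothesis rev : reversible mu k.
Hypothesis K_finite : joint mu k setT < +oo.
Variables (h : T -> R) (mh : measurable_fun setT h).
Hypothesis h01 : forall x, (0 <= h x <= 1)%R.
Variables (A B : set T).
Hypotheses (mA : measurable A) (mB : measurable B) (AB : A `&` B = set0).
Hypotheses (hA : forall x, A x -> h x = 1%R) (hB : forall x, B x -> h x = 0%R).
Hypothesis harmonic :
  {ae mu, forall x, ~ A x -> ~ B x -> outflow k h x = inflow k h x}.
Variable c : R.
Hypotheses (c_gt0 : (0 < c)%R) (cE : energy mu k h = c%:E).
Local Notation K := (joint mu k).
Local Notation drop := (potential_drop h).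
Local Notation infl := (inflow k h).
Local Notation outfl := (outflow k h).

(** At a point without inflow the convention 0 * +oo = 0 makes the weight 0, so
    that such a point is a dead end. *)
Let p (e : T * T) : \bar R :=
  (\1_(~` A) e.1)%:E * ((drop (e.2, e.1))%:E * (infl e.1)^-1).

Let rho (x : T) : \bar R := (c^-1)%:E * ((\1_B x)%:E * infl x).

(** The normalised flow through x, which in A has to be read off the outflow. *)
Let eta (x : T) : \bar R := (c^-1)%:E * (infl x + (\1_A x)%:E * outfl x).

Let ci0 : 0 <= (c^-1)%:E :> \bar R.
Proof. by rewrite lee_fin invr_ge0 ltW. Qed.

Let indic_ge0 E (x : T) : 0 <= (\1_E x)%:E :> \bar R.
Proof. by rewrite lee_fin. Qed.

Let mindic E : measurable E -> measurable_fun setT (fun x : T => (\1_E x)%:E : \bar R).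
Proof. by move=> mE; apply/measurable_EFinP; exact: measurable_indic. Qed.

Let in0 x : 0 <= infl x. Proof. exact: inflow_ge0. Qed.

Let out0 x : 0 <= outfl x. Proof. exact: outflow_ge0. Qed.

Let minfl : measurable_fun setT infl. Proof. exact: measurable_inflow. Qed.

Let moutfl : measurable_fun setT outfl. Proof. exact: measurable_outflow. Qed.

Let drop0 e : 0 <= (drop e)%:E.
Proof. by rewrite lee_fin potential_drop_ge0. Qed.

Let mdrop : measurable_fun setT (EFin \o drop : T * T -> \bar R).
Proof. exact: measurable_potential_drop. Qed.

Let mdropV : measurable_fun setT (fun e => (drop (e.2, e.1))%:E : \bar R).
Proof. exact: measurableT_comp mdrop (@measurable_swap _ T). Qed.

Let p0 e : 0 <= p e.
Proof. by rewrite /p !mule_ge0// inve_ge0. Qed.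

Let mp : measurable_fun setT p.
Proof.
apply: emeasurable_funM.
  exact: measurableT_comp (mindic (measurableC mA)) measurable_fst.
apply: emeasurable_funM => //.
have minflV : measurable_fun setT (fun x => (infl x)^-1).
  exact: measurableT_comp (@measurable_inve R) minfl.
exact: measurableT_comp minflV measurable_fst.
Qed.

Let rho0 x : 0 <= rho x. Proof. by rewrite /rho !mule_ge0. Qed.

Let mrho : measurable_fun setT rho.
Proof. by apply: measurable_funeM; apply: emeasurable_funM => //; exact: mindic. Qed.

Let eta0 x : 0 <= eta x. Proof. by rewrite /eta mule_ge0// adde_ge0// mule_ge0. Qed.

Let meta : measurable_fun setT eta.
Proof.
apply: measurable_funeM; apply: emeasurable_funD => //.
by apply: emeasurable_funM => //; exact: mindic.
Qed.

Let infl_fin x : infl x < +oo.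
Proof.
apply: (@le_lt_trans _ _ (k x setT)); last first.
  by rewrite ltey_eq (@kernel_finite_transition _ _ _ _ _ k x).
rewrite -[leRHS]mul1e -(integral_cst (k x))//; apply: ge0_le_integral => //.
  exact: measurableT_comp mdropV (measurable_pair1 x).
by move=> y _; rewrite lee_fin potential_drop_le1.
Qed.

Let inflV_le1 x : infl x * (infl x)^-1 <= 1.
Proof.
case: (infl x) (in0 x) => [r| |]//; last by rewrite invey mule0.
rewrite lee_fin le_eqVlt => /predU1P[<-|r0]; first by rewrite mul0e.
by rewrite inver gt_eqF// -EFinM mulfV// gt_eqF.
Qed.

(** Stepping from the stationary density eta along p reproduces the flow of h,
    normalised by the energy. *)
Let eta_step F : measurable_fun [set: T * T] F -> (forall e, 0 <= F e) ->
  \int[mu]_x (eta x * \int[k x]_y (p (x, y) * F (x, y))) <=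
  (c^-1)%:E * \int[K]_e ((drop e)%:E * F (e.2, e.1)).
Proof.
move=> mF F0.
have mdF : measurable_fun setT (fun e : T * T => (drop (e.2, e.1))%:E * F e).
  exact: emeasurable_funM.
have dF0 (e : T * T) : 0 <= (drop (e.2, e.1))%:E * F e by exact: mule_ge0.
have J0 x : 0 <= \int[k x]_y ((drop (y, x))%:E * F (x, y)).
  by apply: integral_ge0 => y _; exact: (dF0 (x, y)).
have mJ := measurable_kernel_integral k mdF dF0.
rewrite integral_joint_swap//; last 2 first.
- apply: emeasurable_funM => //.
  exact: measurableT_comp mF (@measurable_swap _ T).
- by move=> e; exact: mule_ge0.
rewrite (_ : \int[K]_e _ = \int[K]_e ((drop (e.2, e.1))%:E * F e)); last first.
  by apply: eq_integral => -[x y].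
rewrite integral_joint// -ge0_integralZl//.
apply: ge0_le_integral => //.
- move=> x _; rewrite mule_ge0//; apply: integral_ge0 => y _.
  exact: mule_ge0.
- apply: emeasurable_funM => //.
  apply: (@measurable_kernel_integral _ _ _ k (fun e => p e * F e)).
    exact: emeasurable_funM.
  by move=> e; exact: mule_ge0.
- exact: measurable_funeM.
move=> x _; rewrite -muleA; apply: lee_wpmul2l => //.
rewrite (_ : \int[k x]_y _ = ((\1_(~` A) x)%:E * (infl x)^-1) *
    \int[k x]_y ((drop (y, x))%:E * F (x, y))); last first.
  rewrite -ge0_integralZl//.
  - by apply: eq_integral => y _; rewrite /p/= -!muleA [X in _ * X]muleCA.
  - exact: measurableT_comp mdF (measurable_pair1 x).
  - by move=> y _; exact: (dF0 (x, y)).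
  - by rewrite mule_ge0// inve_ge0.
rewrite !indicE in_setC; case: (x \in A) => /=.
  by rewrite !mul0e mule0.
rewrite mul0e adde0 mul1e muleA -[leRHS]mul1e.
exact: lee_wpmul2r.
Qed.

(** Balance off A and B: what enters x in one step, plus what starts at x, does
    not exceed the normalised flow through x. *)
Let eta_excessive b : measurable_fun setT b -> (forall x, 0 <= b x) ->
  start_mean mu rho b + \int[mu]_x (eta x * transfer k p b x) <=
  \int[mu]_x (eta x * b x).
Proof.
move=> mb b0.
have mb2 : measurable_fun setT (fun e : T * T => b e.2).
  exact: measurableT_comp mb measurable_snd.
have step := eta_step mb2 (fun e => b0 e.2).
apply: (@le_trans _ _ (start_mean mu rho b +
    (c^-1)%:E * \int[K]_e ((drop e)%:E * b e.1))); first exact: leeD2l.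
rewrite -integral_outflow// -ge0_integralZl//; last 2 first.
- exact: emeasurable_funM.
- by move=> x _; exact: mule_ge0.
rewrite /start_mean -ge0_integralD//; last 4 first.
- by move=> x _; exact: mule_ge0.
- exact: emeasurable_funM.
- by move=> x _; rewrite !mule_ge0.
- by apply: measurable_funeM; exact: emeasurable_funM.
apply: ae_ge0_le_integral => //.
- by move=> x _; rewrite adde_ge0// !mule_ge0.
- apply: emeasurable_funD; first exact: emeasurable_funM.
  by apply: measurable_funeM; exact: emeasurable_funM.
- by move=> x _; exact: mule_ge0.
- exact: emeasurable_funM.
apply: filterS harmonic => x hx _.
rewrite /rho /eta -muleA -ge0_muleDr ?mule_ge0// -[leRHS]muleA.
apply: lee_wpmul2l => //; rewrite -ge0_muleDl ?mule_ge0//.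
apply: lee_wpmul2r => //.
have [Ax|Ax] := pselect (A x).
  have Bx : ~ B x by move=> Bx; rewrite -[False]/(set0 x) -AB.
  by rewrite !indicE (mem_set Ax) (memNset Bx) mul0e mul1e add0e leeDr.
have [Bx|Bx] := pselect (B x).
  by rewrite (outflow_sink k h01 hB Bx) adde0 mule0 adde0 indicE mem_set// mul1e.
by rewrite hx// !indicE (memNset Ax) (memNset Bx) !mul0e add0e adde0.
Qed.

Let eta_fin : \int[mu]_x eta x < +oo.
Proof.
have le_drop : \int[K]_e (drop e)%:E < +oo.
  rewrite (_ : \int[K]_e _ = \int[K]_e ((drop e)%:E * cst 1 e)).
    by apply: integral_potential_drop_fin => // e; rewrite lee01 lexx.
  by apply: eq_integral => e _; rewrite mule1.
have inE : \int[mu]_x infl x = \int[K]_e (drop e)%:E.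
  transitivity (\int[mu]_x (infl x * cst 1 x)).
    by apply: eq_integral => x _; rewrite mule1.
  by rewrite integral_inflow//; apply: eq_integral => e _; rewrite mule1.
have outE : \int[mu]_x outfl x = \int[K]_e (drop e)%:E.
  transitivity (\int[mu]_x (outfl x * cst 1 x)).
    by apply: eq_integral => x _; rewrite mule1.
  by rewrite integral_outflow//; apply: eq_integral => e _; rewrite mule1.
apply: (@le_lt_trans _ _ ((c^-1)%:E * (\int[mu]_x infl x + \int[mu]_x outfl x))).
  rewrite -ge0_integralD// -ge0_integralZl//; last 2 first.
  - exact: emeasurable_funD.
  - by move=> x _; exact: adde_ge0.
  apply: ge0_le_integral => //.
    by apply: measurable_funeM; exact: emeasurable_funD.
  move=> x _; apply: lee_wpmul2l => //; apply: leeD2l.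
  rewrite -[leRHS]mul1e; apply: lee_wpmul2r => //.
  by rewrite lee_fin indicE; case: (_ \in _).
by rewrite inE outE lte_mul_pinfty// lte_add_pinfty.
Qed.

Let rho1 : start_mean mu rho (cst 1) = 1.
Proof.
rewrite /start_mean.
transitivity ((c^-1)%:E * \int[mu]_x ((\1_B x)%:E * infl x)).
  rewrite -ge0_integralZl//.
  - by apply: eq_integral => x _; rewrite mule1.
  - by apply: emeasurable_funM => //; exact: mindic.
  - by move=> x _; exact: mule_ge0.
rewrite (_ : \int[mu]_x _ = energy mu k h).
  by rewrite cE -EFinM mulVf// gt_eqF.
rewrite (energy_inflow rev K_finite mh h01 mB hA hB harmonic) [RHS]integral_mkcond.
apply: eq_integral => x _; rewrite patchE indicE.
by case: ifPn => _; rewrite ?mul1e ?mul0e.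
Qed.

Let dead := ~` A `&` [set x | infl x = 0].

Let mdead : measurable dead.
Proof.
apply: measurableI; first exact: measurableC.
rewrite -[X in measurable X]setTI.
exact: (minfl measurableT (emeasurable_set1 0)).
Qed.

Let transfer1 x : transfer k p (cst 1) x = (\1_(~` A) x)%:E * (infl x * (infl x)^-1).
Proof.
rewrite /transfer [X in _ * X]muleC muleA.
rewrite -ge0_integralZl//.
- by apply: eq_integral => y _; rewrite mule1 /p/= [X in _ * X]muleC muleA.
- exact: measurableT_comp mdropV (measurable_pair1 x).
- by rewrite mule_ge0// inve_ge0.
Qed.

Let trichotomy x :
  (\1_A x)%:E + (\1_dead x)%:E + transfer k p (cst 1) x = 1.
Proof.
rewrite transfer1 !indicE in_setC.
have [|xA] := boolP (x \in A) => /=.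
  rewrite inE => Ax; rewrite memNset; last by case.
  by rewrite mul0e !adde0.
have nA : ~ A x by move: xA; rewrite notin_setE.
rewrite add0e mul1e; have [x0|xn0] := pselect (infl x = 0).
  by rewrite mem_set// x0 mul0e adde0.
rewrite memNset; last by case.
rewrite add0e; case: (infl x) (in0 x) (infl_fin x) xn0 => [r| |]// _ _ /eqP.
by rewrite eqe => rn0; rewrite inver (negbTE rn0) -EFinM mulfV.
Qed.

Let eta_dead : \int[mu]_x (eta x * (\1_dead x)%:E) = 0.
Proof.
apply: integral0_eq => x _; rewrite indicE.
have [[Ax x0]|xd] := pselect (dead x).
  by rewrite /eta x0 add0e indicE memNset// mul0e mule0 mul0e.
by rewrite memNset// mule0.
Qed.

Let law_setT : path_law mu k mp p0 mrho rho0 mA setT = 1.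
Proof.
rewrite -(path_functional1 mp p0 mrho rho0 eta0 mA eta_excessive rho1 eta_fin
  mdead trichotomy eta_dead).
by congr (path_functional _ _ _ _ _ _); apply/funext => s; rewrite /= indicT.
Qed.

(** The law of the chain that runs along the flow of h backwards from B and is
    stopped in A. Its first vertex is distributed on B according to the inflow,
    and every vertex is put in front of the previous ones. *)
Let law : probability (seq T) R :=
  mnormalize (path_law mu k mp p0 mrho rho0 mA) (\d_[::]).

Let lawE E : law E = path_law mu k mp p0 mrho rho0 mA E.
Proof.
rewrite /law/= /mnormalize law_setT; case: ifPn => [|_].
  by rewrite orbC /= eqe oner_eq0.
by rewrite /= invr1 mule1.
Qed.

Let law_edge_sum F : measurable_fun setT F -> (forall e, 0 <= F e) ->
  \int[law]_g edge_sum F g <= (c^-1)%:E * \int[K]_e ((drop e)%:E * F e).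
Proof.
move=> mF F0.
rewrite (eq_measure_integral (path_law mu k mp p0 mrho rho0 mA)); last first.
  by move=> E _ _; exact: lawE.
rewrite integral_path_law; last 2 first.
- exact: measurable_edge_sum.
- by move=> g; apply: sume_ge0 => e _; exact: F0.
have subprob x : (\1_A x)%:E + transfer k p (cst 1) x <= 1.
  by rewrite -[leRHS](trichotomy x) addeAC leeDl.
have mFV : measurable_fun setT (fun e : T * T => F (e.2, e.1)).
  exact: measurableT_comp mF (@measurable_swap _ T).
apply: le_trans (path_functional_edge_sum mp p0 mrho rho0 eta0 mA eta_excessive mF F0 subprob) _.
apply: le_trans (eta_step mFV (fun e => F0 _)) _.
by rewrite (_ : \int[K]_e _ = \int[K]_e ((drop e)%:E * F e))//; apply: eq_integral => -[].
Qed.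

Let descending (s : seq T) : Prop := exists x l,
  [/\ s = x :: l, B (last x l) & path (fun x y => h y < h x)%R x l].

Let descending_good s : descending s -> A (head point s) ->
  (paths A B `&` self_avoiding) s.
Proof.
move=> [x [l [-> Bl dl]]] /= Ax.
have gtr_trans : transitive (fun x y => h y < h x)%R.
  by move=> y z t yz ty; exact: lt_trans ty yz.
split; last first.
  have gtr_irr : irreflexive (fun x y => h y < h x)%R by move=> y; rewrite ltxx.
  exact: (sorted_uniq gtr_trans gtr_irr (s := x :: l) dl).
case/lastP: l Bl dl => [|l y] /=.
  by move=> Bx; exfalso; rewrite -[False]/(set0 x) -AB.
rewrite last_rcons => By dl; exists x, l, y; split => // z zl Bz.
have : sorted (fun x y => h y < h x)%R (rcons l y) by apply: path_sorted dl.
rewrite -cats1 sorted_pairwise// pairwise_cat => /andP[/allrelP/(_ z y zl)].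
rewrite mem_head => /(_ isT) + _; rewrite hB// ltNge => /negP; apply.
by rewrite hB.
Qed.

Hypothesis mdiag : measurable [set e : T * T | e.1 = e.2].

Let mgood : measurable (paths A B `&` self_avoiding).
Proof.
by apply: measurableI; [exact: measurable_paths|exact: measurable_self_avoiding].
Qed.

Let law_good : law (paths A B `&` self_avoiding) = 1.
Proof.
rewrite -[X in law X]setCK probability_setC; last exact: measurableC.
rewrite lawE (_ : path_law _ _ _ _ _ _ _ _ = 0) ?sube0//.
apply: (@path_functional_support _ _ _ mu k p rho A descending).
- move=> x; have [Bx|Bx] := pselect (B x); first by right; exists x, [::].
  by left; rewrite /rho indicE memNset// mul0e mule0.
- move=> s y [x [l [-> Bl dl]]]; have [hyx|hxy] := leP (h y) (h x).
    by left; rewrite /p/= /potential_drop/= max_r ?subr_le0// mul0e mule0.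
  by right; exists y, (x :: l); split => //=; rewrite hxy.
- move=> s ds As; rewrite /= indicE memNset//= => bad.
  by apply: bad; exact: descending_good.
Qed.

Let law_paths : law (paths A B) = 1.
Proof.
apply/eqP; rewrite eq_le probability_le1 ?andTb; last exact: measurable_paths.
rewrite -law_good; apply: le_measure; rewrite ?inE//.
exact: measurable_paths.
Qed.

Let law_edge_measure E : measurable E ->
  edge_measure law E <= (c^-1)%:E * \int[K]_e ((drop e)%:E * (\1_E e)%:E).
Proof.
move=> mE; apply: law_edge_sum; last by move=> e; rewrite lee_fin.
by apply/measurable_EFinP; exact: measurable_indic.
Qed.

Let law_path_laws : path_laws K A B law.
Proof.
split; first exact: law_paths.
  apply/null_content_dominatesP => E mE KE0; apply/eqP.
  rewrite eq_le measure_ge0 andbT; apply: le_trans (law_edge_measure mE) _.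
  suff -> : \int[K]_e ((drop e)%:E * (\1_E e)%:E) = 0 by rewrite mule0.
  apply/eqP; rewrite eq_le integral_ge0 ?andbT; last first.
    by move=> e _; rewrite mule_ge0// lee_fin.
  rewrite -[leRHS]KE0; apply: (@le_trans _ _ (\int[K]_e (\1_E e)%:E)); last first.
    by rewrite integral_indic// setIT.
  apply: ge0_le_integral => //.
  - by move=> e _; rewrite mule_ge0// lee_fin.
  - apply: emeasurable_funM => //.
    by apply/measurable_EFinP; exact: measurable_indic.
  - by apply/measurable_EFinP; exact: measurable_indic.
  - move=> e _; rewrite -[leRHS]mul1e; apply: lee_wpmul2r; rewrite lee_fin//.
    exact: potential_drop_le1.
pose chi : set (T * T) := [set e | 0 < (drop e)%:E].
have mchi : measurable chi.
  by rewrite -[chi]setTI; apply: emeasurable_fun_o_infty.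
exists chi; split => //.
  apply/eqP; rewrite eq_le measure_ge0 andbT.
  apply: le_trans (law_edge_measure (measurableC mchi)) _.
  rewrite integral0_eq ?mule0// => e _; rewrite indicE.
  have [e0|e0] := pselect (chi e); first by rewrite memNset ?mule0// => /(_ e0).
  suff -> : (drop e)%:E = 0 by rewrite mul0e.
  by apply/eqP; rewrite eq_le drop0 andbT leNgt; apply/negP.
move=> x y; rewrite /chi/= !lte_fin /potential_drop/= !lt_max !ltxx !orbF !subr_gt0.
by move=> yx xy; have := lt_trans yx xy; rewrite ltxx.
Qed.

(** The edge measure of the law is at most the normalised flow, hence the mean
    of the sum of its density along the path is at most the inverse of the
    energy; convexity of the inverse gives the bound. *)
Let le_inverse_density_mean : energy mu k h <= inverse_density_mean K law.
Proof.
have [_ PK _] := law_path_laws.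
have fP := edge_measure_density K_finite PK.
rewrite /inverse_density_mean; set f := density _ _ in fP *.
have [mf f0 _] := fP.
have S0 g : 0 <= edge_sum f g by apply: sume_ge0 => e _; exact: f0.
have mS : measurable_fun setT (edge_sum f) by exact: measurable_edge_sum.
have mean_le : \int[law]_g edge_sum f g <= (c^-1)%:E.
  apply: le_trans (law_edge_sum mf f0) _.
  rewrite (_ : \int[K]_e _ = \int[K]_e (f e * (drop e)%:E)); last first.
    by apply: eq_integral => e _; rewrite muleC.
  rewrite -(integral_is_density fP mdrop drop0) integral_edge_measure//.
  apply: (@le_trans _ _ ((c^-1)%:E * ((c^-1)%:E * c%:E))); last first.
    by rewrite -!EFinM mulVf ?gt_eqF// mulr1.
  apply: lee_wpmul2l => //; apply: le_trans (law_edge_sum mdrop drop0) _.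
  by rewrite -cE.
(* tangent at sum f = 1 / c *)
have tangent g : (2 * c)%:E <= (edge_sum f g)^-1 + (c * c)%:E * edge_sum f g.
  have := sqr_div_tangent (S0 g) (@ler01 R) (ltW c_gt0).
  by rewrite !mulr1 mul1e.
have mSV : measurable_fun setT (fun g => (edge_sum f g)^-1).
  exact: measurableT_comp (@measurable_inve R) mS.
have SV0 g : 0 <= (edge_sum f g)^-1 by rewrite inve_ge0.
have cc0 : 0 <= (c * c)%:E by rewrite lee_fin mulr_ge0// ltW.
have : (2 * c)%:E <= \int[law]_g (edge_sum f g)^-1 + c%:E.
  apply: (@le_trans _ _ (\int[law]_g ((edge_sum f g)^-1 + (c * c)%:E * edge_sum f g))).
    rewrite -[leLHS]mule1 -(@probability_setT _ _ _ law) -integral_cst//.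
    apply: ge0_le_integral => //.
    - by move=> g _; rewrite lee_fin mulr_ge0// ltW.
    - by apply: emeasurable_funD => //; exact: measurable_funeM.
  rewrite ge0_integralD//; [|by move=> g _; exact: mule_ge0|exact: measurable_funeM].
  rewrite ge0_integralZl//; apply: leeD2l.
  apply: (@le_trans _ _ ((c * c)%:E * (c^-1)%:E)); first exact: lee_wpmul2l.
  by rewrite -EFinM mulfK ?gt_eqF.
by rewrite -leeBlDr// -EFinB mulr2n mulrDl !mul1r addrK cE.
Qed.

(** The supremum is attained by the law along the flow of h, whose paths are
    self-avoiding because h strictly decreases along them. *)
Lemma exists_optimal_law : exists P : probability (seq T) R,
  [/\ path_laws K A B P, P (paths A B `&` self_avoiding) = 1 &
      energy mu k h <= inverse_density_mean K P].
Proof. by exists law; split. Qed.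

End optimal.

(** * The equilibrium potential of the jump process *)

Section jump_chain.
Context d d' (T : measurableType d) (W : measurableType d') (R : realType).
Variables (k : R.-ftker T ~> T) (Px : R.-pker T ~> W).
Variables (Y : nat -> W -> T) (S : nat -> W -> \bar R).
Hypothesis X_jump : is_jump_process k Px Y S.
Variables (A B : set T).
Hypotheses (mA : measurable A) (mB : measurable B) (AB : A `&` B = set0).

Let mY n : measurable_fun setT (Y n). Proof. exact: jump_chain_measurable X_jump n. Qed.

Let mS n : measurable_fun setT (S n). Proof. exact: holding_time_measurable X_jump n. Qed.

Let S_gt0 n w : 0 < S n w. Proof. exact: holding_time_gt0 X_jump n w. Qed.

Let inner := ~` A `&` ~` B.

Let minner : measurable inner.
Proof. by apply: measurableI; exact: measurableC. Qed.

Definition chain_hits (n : nat) : set W :=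
  [set w | (forall i, (i < n)%N -> (~` A `&` ~` B) (Y i w)) /\ A (Y n w)].

Let sets_upto n (i : nat) : set T := if (i < n)%N then inner else A.

Let chain_hitsE n : chain_hits n =
  [set w | forall i, (i < n.+1)%N -> sets_upto n i (Y i w) /\ (0%R)%:E < S i w].
Proof.
apply/seteqP; split => w /=.
  move=> [Dw Aw] i; rewrite ltnS => i_n; split => //.
  rewrite /sets_upto; case: ltnP => ni; first exact: Dw.
  by have -> : i = n by apply/eqP; rewrite eqn_leq i_n ni.
move=> Hw; split => [i i_n|].
  have [+ _] := Hw i (ltnW i_n).
  by rewrite /sets_upto i_n.
have [+ _] := Hw n (ltnSn n).
by rewrite /sets_upto ltnn.
Qed.

Lemma measurable_chain_hits n : measurable (chain_hits n).
Proof.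
have mpre C i : measurable C -> measurable [set w | C (Y i w)].
  by move=> mC; rewrite -[X in measurable X]setTI; exact: mY.
rewrite (_ : chain_hits n = \bigcap_(i in [set i | (i < n)%N])
    [set w | inner (Y i w)] `&` [set w | A (Y n w)])//.
apply: measurableI; last exact: mpre.
by apply: fin_bigcap_measurable => [|i _]; [exact: finite_II|exact: mpre].
Qed.

Let hit_law n x := Px x (chain_hits n).

Let hit_lawE n x : hit_law n x = jump_law k (sets_upto n) (fun=> 0%R) n.+1 x.
Proof.
rewrite /hit_law chain_hitsE.
have mC i : measurable (sets_upto n i) by rewrite /sets_upto; case: ifP.
exact: (jump_processE X_jump n.+1 x mC (fun=> lexx 0%R)).
Qed.

Let hit_law0 x : hit_law 0 x = (\1_A x)%:E.
Proof.
rewrite hit_lawE /= mul0r oppr0 expR0 mule1 integral_cst// mul1e -[RHS]mule1.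
congr (_ * _); exact: (@probability_setT _ _ _ (mnormalize (k x) \d_x)).
Qed.

Let hit_lawS n x :
  hit_law n.+1 x = (\1_inner x)%:E * \int[jump_prob k x]_y hit_law n y.
Proof.
rewrite hit_lawE; set m := n.+1; rewrite /= mul0r oppr0 expR0 mule1.
congr (_ * _); apply: eq_integral => y _; exact/esym/hit_lawE.
Qed.

Let trivIset_hits : trivIset setT chain_hits.
Proof.
apply/trivIsetP => i j _ _; wlog ij : i j / (i < j)%N.
  move=> H; rewrite neq_ltn => /orP[|] ij; first by rewrite H// ltn_eqF.
  by rewrite setIC H// ltn_eqF.
move=> _; apply/seteqP; split => // w [[_ Aw] [Dw _]].
by have [+ _] := Dw i ij.
Qed.

Definition hitting_law (x : T) : \bar R := Px x (\bigcup_n chain_hits n).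

(** The probability that the jump chain hits A before B. It satisfies the mean
    value property at every point off A and B, and it needs no holding times. *)
Definition hitting_potential (x : T) : R := fine (hitting_law x).

Let mhits : measurable (\bigcup_n chain_hits n).
Proof. by apply: bigcup_measurable => n _; exact: measurable_chain_hits. Qed.

Let hitting_lawE x : hitting_law x = \sum_(n <oo) hit_law n x.
Proof. by rewrite /hitting_law measure_semi_bigcup//; exact: measurable_chain_hits. Qed.

Let mhit_law n : measurable_fun setT (hit_law n).
Proof. exact: (measurable_kernel Px _ (measurable_chain_hits n)). Qed.

Let hitting_law_fin x : (hitting_potential x)%:E = hitting_law x.
Proof. by rewrite fineK//; exact: (@kernel_finite_transition _ _ _ _ _ Px x _ mhits). Qed.

Lemma measurable_hitting_potential : measurable_fun setT hitting_potential.
Proof.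
apply: measurableT_comp; first exact: fine_measurable.
exact: (measurable_kernel Px _ mhits).
Qed.

Lemma hitting_potential01 x : (0 <= hitting_potential x <= 1)%R.
Proof. 
rewrite -!lee_fin hitting_law_fin measure_ge0 -[1%:E](prob_kernel (s := Px) x).
by apply: le_measure; rewrite ?inE. Qed.

(** First-step decomposition. *)
Let hitting_law_step x :
  hitting_law x = (\1_A x)%:E + (\1_inner x)%:E * \int[jump_prob k x]_y hitting_law y.
Proof.
rewrite hitting_lawE nneseries_recl// hit_law0; congr (_ + _).
under [X in _ * X]eq_integral do rewrite hitting_lawE.
rewrite integral_nneseries// -nneseries_Zl//; last by move=> n; exact: integral_ge0.
rewrite -(nneseries_addn 1)//.
by apply: eq_eseriesr => n _; rewrite addn1 hit_lawS.
Qed.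

Lemma hitting_potential_source x : A x -> hitting_potential x = 1%R.
Proof.
move=> Ax; rewrite /hitting_potential hitting_law_step !indicE mem_set// memNset.
  by rewrite mul0e adde0.
by case.
Qed.

Lemma hitting_potential_sink x : B x -> hitting_potential x = 0%R.
Proof.
move=> Bx; have Ax : ~ A x by move=> Ax; rewrite -[False]/(set0 x) -AB.
rewrite /hitting_potential hitting_law_step !indicE !memNset//; last by case.
by rewrite mul0e adde0.
Qed.

Let hitting_potential_mean x : ~ A x -> ~ B x ->
  \int[k x]_y (hitting_potential y)%:E = (hitting_potential x)%:E * k x setT.
Proof.
move=> Ax Bx; under eq_integral do rewrite hitting_law_fin.
rewrite hitting_law_fin.
have mlaw : measurable_fun setT hitting_law by exact: (measurable_kernel Px _ mhits).
have kfin : k x setT \is a fin_num by exact: kernel_finite_transition.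
have [k0|kn0] := eqVneq (k x setT) 0.
  rewrite k0 mule0 (eq_measure_integral mzero).
    by rewrite integral_measure_zero.
  move=> E mE _; apply/eqP; rewrite eq_le measure_ge0 andbT.
  rewrite -[leRHS]k0; apply: le_measure; rewrite ?inE//.
have law_step : hitting_law x = \int[jump_prob k x]_y hitting_law y.
  rewrite [LHS]hitting_law_step !indicE memNset// add0e mem_set ?mul1e//.
rewrite law_step.
have kV0 : 0 <= ((fine (k x setT))^-1)%:E by rewrite lee_fin invr_ge0 fine_ge0.
have -> : \int[jump_prob k x]_y hitting_law y =
    ((fine (k x setT))^-1)%:E * \int[k x]_y hitting_law y.
  apply: (@integral_functional _ _ _ (jump_prob k x)
    (fun f => ((fine (k x setT))^-1)%:E * \int[k x]_y f y)) => //.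
  - move=> E mE; rewrite integral_indic// setIT /jump_prob/= /mnormalize.
    rewrite (negbTE kn0)/= lt_eqF ?ltey_eq ?kfin//=.
    by rewrite muleC.
  - by move=> f f0; apply: mule_ge0 => //; exact: integral_ge0.
  - by move=> r f r0 mf f0; rewrite ge0_integralZl// muleCA.
  - move=> f mf f0; rewrite integral_nneseries// nneseries_Zl// => n.
    exact: integral_ge0.
rewrite muleAC -[X in _ * X * _](fineK kfin) -EFinM mulVf ?mul1e//.
by rewrite fine_eq0.
Qed.

(** The larger of two potentials is the smaller one plus the drop, in either
    order, so a mean value property turns into the balance of the flows. *)
Lemma hitting_potential_harmonic x : ~ A x -> ~ B x ->
  outflow k hitting_potential x = inflow k hitting_potential x.
Proof.
move=> Ax Bx; set h := hitting_potential.
have mh : measurable_fun setT (EFin \o h).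
  by apply/measurable_EFinP; exact: measurable_hitting_potential.
have h0 y : 0 <= (h y)%:E by rewrite lee_fin; have /andP[] := hitting_potential01 y.
have mdrop := measurable_potential_drop measurable_hitting_potential.
have drop0 e : 0 <= (potential_drop h e)%:E by rewrite lee_fin potential_drop_ge0.
have hx_fin : \int[k x]_y (h y)%:E \is a fin_num.
  by rewrite hitting_potential_mean// fin_numM// kernel_finite_transition.
have m1 : measurable_fun setT (fun y => (potential_drop h (x, y))%:E).
  exact: measurableT_comp mdrop (measurable_pair1 x).
have m2 : measurable_fun setT (fun y => (potential_drop h (y, x))%:E).
  exact: measurableT_comp mdrop (measurable_pair2 x).
have balance : outflow k h x + \int[k x]_y (h y)%:E =
       inflow k h x + \int[k x]_y (h y)%:E.
  rewrite {2}hitting_potential_mean// -integral_cst// /outflow /inflow.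
  rewrite -!ge0_integralD//; last by move=> y _; exact: (h0 x).
  apply: eq_integral => y _ /=; rewrite -!EFinD /potential_drop/=; congr (_%:E).
    by rewrite !addr_maxl !subrK !add0r maxC.
by rewrite -(addeK (outflow k h x) hx_fin) balance addeK.
Qed.

End jump_chain.

(** * Hitting times of the jump process *)

Section hitting_times.
Context d d' (T : measurableType d) (W : measurableType d') (R : realType).
Variables (Y : nat -> W -> T) (S : nat -> W -> \bar R).
Hypothesis S_gt0 : forall n w, 0 < S n w.
Local Notation J := (jump_time S).
Local Notation tau := (hitting_time Y S).

Let jump_time_ge0 n w : 0 <= J n w.
Proof. by apply: sume_ge0 => i _; exact: ltW. Qed.

Let jump_timeS n w : J n.+1 w = J n w + S n w.
Proof. by rewrite /jump_time big_ord_recr. Qed.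

Lemma le_jump_time w m n : (m <= n)%N -> J m w <= J n w.
Proof.
move=> /subnKC <-; elim: (n - m)%N => [|i IH]; first by rewrite addn0.
by rewrite addnS jump_timeS (le_trans IH)// leeDl// ltW.
Qed.

Lemma lt_jump_time w n : J n w < +oo -> J n w < J n.+1 w.
Proof. by move=> Joo; rewrite jump_timeS lteDl// ge0_fin_numE. Qed.

Let state_window w n t : J n w <= t%:E -> t%:E < J n.+1 w ->
  state Y S t w = Some (Y n w).
Proof.
move=> nt tn; rewrite /state.
apply: xget_subset1; first by exists n => //; apply/andP.
suff H m : J m w <= t%:E < J m.+1 w -> m = n.
  by move=> _ _ [i /H -> <-] [j /H -> <-].
move=> /andP[mt tm]; apply/eqP; rewrite eqn_leq; apply/andP; split.
  rewrite leqNgt; apply/negP => /(le_jump_time w) nm.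
  by have := lt_le_trans tn (le_trans nm mt); rewrite ltxx.
rewrite leqNgt; apply/negP => /(le_jump_time w) mn.
by have := lt_le_trans tm (le_trans mn nt); rewrite ltxx.
Qed.

(** The n-th candidate for the hitting time; the convention +oo discards it when
    the chain is not in C. *)
Definition entry_time (C : set T) (n : nat) (w : W) : \bar R :=
  if Y n w \in C then J n w else +oo.

(** The infimum over positive times sees the state at time 0 as well, because
    the first holding time is positive. *)
Lemma hitting_timeE C w : tau C w = einfs (entry_time C ^~ w) 0%N.
Proof.
apply/eqP; rewrite eq_le; apply/andP; split.
  apply: le_ereal_inf_tmp => _ [n _ <-]; rewrite /entry_time.
  case: ifPn => [|_]; last by rewrite leey.
  rewrite inE => CY; have [Joo|] := ltP (J n w) (+oo); last first.
    by rewrite leye_eq => /eqP ->; rewrite leey.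
  have Jfin : J n w \is a fin_num by rewrite ge0_fin_numE.
  apply/lee_addgt0Pr => e e0.
  have [t [t0 Jt tJ te]] : exists t : R,
      [/\ (0 < t)%R, J n w <= t%:E, t%:E < J n.+1 w & t%:E <= J n w + e%:E].
    have Sn := S_gt0 n w; have j0 := jump_time_ge0 n w.
    move: Jfin j0; rewrite jump_timeS; case: (J n w) => // j _; rewrite lee_fin => j0.
    case: (S n w) Sn => [s| |]// Sn; last first.
      exists (j + e)%R; rewrite addey// ltry -EFinD lexx lee_fin lerDl ltW//.
      by split => //; rewrite ltr_wpDl.
    rewrite lte_fin in Sn; pose m := Num.min (s / 2)%R e.
    have m0 : (0 < m)%R by rewrite lt_min e0 divr_gt0.
    exists (j + m)%R; rewrite -!EFinD !lee_fin lte_fin; split.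
    - by rewrite ltr_wpDl.
    - by rewrite lerDl ltW.
    - rewrite ltrD2l (@le_lt_trans _ _ (s / 2)%R) ?ge_min ?lexx//.
      by rewrite ltr_pdivrMr// ltr_pMr// ltr1n.
    - by rewrite lerD2l ge_min lexx orbT.
  apply: le_trans te; apply: ereal_inf_lbound; exists t => //; split => //.
  by exists (Y n w) => //; exact: state_window.
apply: le_ereal_inf_tmp => _ [t [t0 [y + Cy]] <-].
rewrite /state; case: xgetP => // _ -> [n /andP[Jt tJ] <-] [] yE.
apply: (@le_trans _ _ (entry_time C n w)).
  by apply: ereal_inf_lbound; exists n.
by rewrite /entry_time mem_set// yE.
Qed.

Lemma hitting_time_le C n w : C (Y n w) -> tau C w <= J n w.
Proof.
move=> CY; rewrite hitting_timeE; apply: ereal_inf_lbound; exists n => //.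
by rewrite /entry_time mem_set.
Qed.

Lemma hitting_time_lt C w x : tau C w < x -> exists2 n, C (Y n w) & J n w < x.
Proof.
rewrite hitting_timeE => /ereal_inf_lt[_ [n _ <-]].
rewrite /entry_time; case: ifPn => [|_]; first by rewrite inE => CY Jx; exists n.
by rewrite ltNge leey.
Qed.

Lemma le_hitting_time C w x : (forall n, C (Y n w) -> x <= J n w) -> x <= tau C w.
Proof.
move=> xJ; rewrite hitting_timeE; apply: le_ereal_inf_tmp => _ [n _ <-].
rewrite /entry_time; case: ifPn => [|_]; last exact: leey.
by rewrite inE; exact: xJ.
Qed.

(** If A is hit at all, hitting A before B is an event of the jump chain alone,
    whatever the holding times. *)
Lemma hitting_time_before (A B : set T) w : A `&` B = set0 -> tau A w < +oo ->
  (tau A w < tau B w)%E = `[< (\bigcup_n chain_hits Y A B n) w >].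
Proof.
move=> AB Aoo; apply/idP/asboolP.
  move=> /hitting_time_lt[n AY JB].
  have ex_N : exists m, `[< A (Y m w) \/ B (Y m w) >].
    by exists n; apply/asboolP; left.
  (* the first visit to A or B, which cannot be to B *)
  case: (ex_minnP ex_N) => N /asboolP AorB minN.
  have Nn : (N <= n)%N by apply: minN; apply/asboolP; left.
  exists N => //; split => [i iN|].
    have iN' : ~ (N <= i)%N by rewrite leqNgt iN.
    by split => Ci; apply: iN'; apply: minN; apply/asboolP; [left|right].
  case: AorB => // BY; exfalso.
  have := lt_le_trans JB (le_trans (hitting_time_le BY) (le_jump_time w Nn)).
  by rewrite ltxx.
move=> [N _ [Dw AN]]; have [n An Jn] := hitting_time_lt Aoo.
have Nn : (N <= n)%N by rewrite leqNgt; apply/negP => /Dw[/(_ An)].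
have JN : J N w < +oo by exact: le_lt_trans (le_jump_time w Nn) Jn.
apply: le_lt_trans (hitting_time_le AN) _.
apply: lt_le_trans (lt_jump_time JN) _.
apply: le_hitting_time => m Bm; apply: le_jump_time.
rewrite ltnNge; apply/negP; rewrite leq_eqVlt => /predU1P[mN|/Dw[_ /(_ Bm)]//].
by rewrite -[False]/(set0 (Y m w)) -AB mN; split => //; rewrite -mN.
Qed.

Hypothesis mY : forall n, measurable_fun setT (Y n).
Hypothesis mS : forall n, measurable_fun setT (S n).

Lemma measurable_hitting_time C : measurable C -> measurable_fun setT (tau C).
Proof.
move=> mC; rewrite (_ : tau C = fun w => einfs (entry_time C ^~ w) 0%N); last first.
  by apply/funext => w; rewrite hitting_timeE.
apply: (measurable_fun_einfs (f := entry_time C)) => n.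
apply: measurable_fun_ifT => //.
- apply: (measurable_fun_bool true); rewrite setTI.
  rewrite (_ : _ @^-1` _ = Y n @^-1` C); last first.
    by apply/seteqP; split => w /=; [exact: set_mem|exact: mem_set].
  by rewrite -[X in measurable X]setTI; exact: mY.
- by apply: emeasurable_sum => i; exact: mS.
Qed.

End hitting_times.

(** * The capacity as a flow *)

Section capacity_outflow.
Context d d' (T : measurableType d) (W : measurableType d') (R : realType).
Variables (k : R.-ftker T ~> T) (Px : R.-pker T ~> W).
Variables (Y : nat -> W -> T) (S : nat -> W -> \bar R).
Hypothesis X_jump : is_jump_process k Px Y S.
Variables (mu : {measure set T -> \bar R}).
Hypothesis rev : reversible mu k.
Hypothesis X_recurrent : recurrent Px Y S mu.
Variables (A B : set T).
Hypotheses (mA : measurable A) (mB : measurable B) (AB : A `&` B = set0).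

Local Notation h0 := (equilibrium_potential Px Y S A B).
Local Notation h1 := (hitting_potential Px Y A B).

Let mtau C : measurable C -> measurable_fun setT (hitting_time Y S C).
Proof.
apply: measurable_hitting_time.
- exact: holding_time_gt0 X_jump.
- exact: jump_chain_measurable X_jump.
- exact: holding_time_measurable X_jump.
Qed.

Let before := [set w | hitting_time Y S A w < hitting_time Y S B w].

Let mbefore : measurable before.
Proof.
have := measurable_fun_lte (mtau mA) (mtau mB).
move=> /(_ measurableT [set true]); rewrite setTI; apply => //.
Qed.

Let hits_before := \bigcup_n chain_hits Y A B n.

Let mhits : measurable hits_before.
Proof.
by apply: bigcup_measurable => n _; exact: (measurable_chain_hits X_jump mA mB).
Qed.

Let prob_le1 E x : measurable E -> Px x E <= 1.
Proof.
by move=> mE; rewrite -(prob_kernel (s := Px) x); apply: le_measure; rewrite ?inE.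
Qed.

Lemma measurable_equilibrium_potential : measurable_fun setT h0.
Proof.
have mmem C : measurable C -> measurable_fun setT (fun x : T => x \in C).
  move=> mC; apply: (measurable_fun_bool true); rewrite setTI.
  rewrite (_ : _ @^-1` _ = C)//.
  by apply/seteqP; split => x /=; [exact: set_mem|exact: mem_set].
apply: measurable_fun_ifT => //; first exact: mmem.
apply: measurable_fun_ifT => //; first exact: mmem.
apply: measurableT_comp; first exact: fine_measurable.
exact: (measurable_kernel Px _ mbefore).
Qed.

Lemma equilibrium_potential_le1 x : (h0 x <= 1)%R.
Proof.
rewrite /equilibrium_potential; case: ifP => // _; case: ifP => // _.
rewrite -lee_fin fineK ?prob_le1//.
exact: (@kernel_finite_transition _ _ _ _ _ Px x _ mbefore).
Qed.

(** By recurrence A is hit almost surely from almost every point, and then the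
    holding times do not matter. *)
Lemma equilibrium_potentialE : 0 < mu A -> {ae mu, forall x, h0 x = h1 x}.
Proof.
move=> muA; apply: filterS (X_recurrent mA muA) => x Ax1.
rewrite /equilibrium_potential; case: ifPn => [|xA].
  by rewrite inE => Ax; rewrite (hitting_potential_source X_jump mA mB).
case: ifPn => [|xB].
  by rewrite inE => Bx; rewrite (hitting_potential_sink X_jump mA mB AB).
congr fine; set H := [set w | hitting_time Y S A w < +oo] in Ax1.
have mH : measurable H.
  rewrite -[H]setTI; exact: (emeasurable_fun_infty_o measurableT (mtau mA)).
have PHC : Px x (~` H) = 0.
  have : Px x (~` H) + Px x H = 1.
    rewrite -measureU//; [|exact: measurableC|by rewrite setICl].
    by rewrite setUCl; exact: prob_kernel.
  rewrite Ax1; have := measure_ge0 (Px x) (~` H).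
  case: (Px x (~` H)) => // r _; rewrite -EFinD => -[/(congr1 (fun z => z - 1)%R)].
  by rewrite addrK subrr => ->.
have split_H E : measurable E -> Px x E = Px x (E `&` H).
  move=> mE; have mEC : measurable (E `&` ~` H).
    by apply: measurableI => //; exact: measurableC.
  have null : Px x (E `&` ~` H) = 0.
    apply/eqP; rewrite eq_le measure_ge0 andbT -PHC.
    by apply: le_measure; rewrite ?inE//; exact: measurableC.
  have : Px x ((E `&` H) `|` (E `&` ~` H)) = Px x (E `&` H) + Px x (E `&` ~` H).
    apply: measureU => //; first exact: measurableI.
    by rewrite setIACA setICr setI0.
  by rewrite null adde0 -setIUr setUv setIT.
rewrite split_H// [RHS]split_H//; congr (Px x _); apply/seteqP; split => w [+ Hw];
  by rewrite /= (hitting_time_before (holding_time_gt0 X_jump) AB Hw) => /asboolP.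
Qed.

(** The generator at a point of A only sees 1 - h, and by reversibility the
    values of h matter up to mu-null sets only. *)
Lemma capacityE : capacity k Px Y S mu A B = \int[mu]_(x in A) outflow k h1 x.
Proof.
have mh0 := measurable_equilibrium_potential.
have mh1 : measurable_fun setT h1 by exact: (measurable_hitting_potential X_jump mA mB).
have h1_le1 x : (h1 x <= 1)%R by have /andP[] := hitting_potential01 X_jump mA mB x.
pose loss (h : T -> R) (x : T) : \bar R := (1 - h x)%:E.
have mloss h : measurable_fun setT h -> measurable_fun setT (loss h).
  by move=> mh; apply/measurable_EFinP; exact: measurable_funB.
have loss0 (h : T -> R) : (forall x, h x <= 1)%R -> forall x, 0 <= loss h x.
  by move=> h_le1 x; rewrite lee_fin subr_ge0.
have mk_loss (h : T -> R) : measurable_fun setT h -> (forall x, h x <= 1)%R ->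
    measurable_fun setT (fun x => \int[k x]_y loss h y).
  move=> mh h_le1.
  apply: (@measurable_kernel_integral _ _ _ k (fun e => loss h e.2)).
    exact: measurableT_comp (mloss h mh) measurable_snd.
  by move=> e; exact: loss0.
have -> : capacity k Px Y S mu A B = \int[mu]_(x in A) \int[k x]_y loss h0 y.
  apply: eq_integral => x; rewrite inE => Ax; rewrite /generator.
  have -> : h0 x = 1%R by rewrite /equilibrium_potential mem_set.
  rewrite -[RHS]oppeK -integral_ge0N; last first.
    by move=> y _; apply: loss0; exact: equilibrium_potential_le1.
  by congr (- _); apply: eq_integral => y _; rewrite /loss -EFinN opprB.
have -> : \int[mu]_(x in A) outflow k h1 x = \int[mu]_(x in A) \int[k x]_y loss h1 y.
  apply: eq_integral => x; rewrite inE => Ax; apply: eq_integral => y _.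
  rewrite /potential_drop/= (hitting_potential_source X_jump mA mB Ax) /loss.
  by rewrite max_l// subr_ge0.
have [A0|muA] := eqVneq (mu A) 0.
  rewrite !null_set_integral//; apply: measurable_funTS; apply: mk_loss => //.
  exact: equilibrium_potential_le1.
have {muA} h01 : {ae mu, forall x, h0 x = h1 x}.
  by apply: equilibrium_potentialE; rewrite lt_def muA measure_ge0.
have swapE (h : T -> R) : measurable_fun setT h -> (forall x, h x <= 1)%R ->
    \int[mu]_(x in A) \int[k x]_y loss h y = \int[mu]_x (loss h x * k x A).
  move=> mh h_le1; pose f (e : T * T) := (\1_A e.1)%:E * loss h e.2.
  have mf : measurable_fun setT f.
    apply: emeasurable_funM; last exact: measurableT_comp (mloss h mh) measurable_snd.
    have mI : measurable_fun setT (fun x : T => (\1_A x)%:E : \bar R).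
      by apply/measurable_EFinP; exact: measurable_indic.
    exact: measurableT_comp mI measurable_fst.
  have f0 e : 0 <= f e by rewrite mule_ge0 ?lee_fin// subr_ge0.
  have mls : measurable_fun setT (loss h) by exact: mloss.
  transitivity (\int[joint mu k]_e f e).
    rewrite (integral_joint mu k mf f0) integral_mkcond; apply: eq_integral => x _.
    rewrite patchE; case: ifPn => xA.
      by apply: eq_integral => y _; rewrite /f/= indicE xA mul1e.
    by rewrite integral0_eq// => y _; rewrite /f/= indicE (negbTE xA) mul0e.
  have mfV : measurable_fun setT (fun e => f (e.2, e.1)).
    exact: measurableT_comp mf (@measurable_swap _ T).
  rewrite (integral_joint_swap rev mf f0) (integral_joint mu k mfV (fun e => f0 _)).
  apply: eq_integral => x _; rewrite /f/=.
  under eq_integral do rewrite muleC.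
  rewrite ge0_integralZl//; last exact: loss0.
    by rewrite integral_indic// setIT.
  by apply/measurable_EFinP; exact: measurable_indic.
have mkA : measurable_fun setT (fun x => k x A) by exact: measurable_kernel.
rewrite !swapE//; last exact: equilibrium_potential_le1.
apply: ge0_ae_eq_integral => //.
- by apply: emeasurable_funM => //; exact: mloss.
- by apply: emeasurable_funM => //; exact: mloss.
- move=> x _; apply: mule_ge0 => //; apply: loss0.
  exact: equilibrium_potential_le1.
- by move=> x _; apply: mule_ge0 => //; exact: loss0.
- by apply: filterS h01 => x h01 _; rewrite /loss h01.
Qed.

End capacity_outflow.

(** * The diagonal of a Polish space *)

(** Balls of radius 1/(n+1) around the points of a countable dense set separate
    points, so the complement of the diagonal is a countable union of
    rectangles. *)
Lemma polish_diagonal_measurable (R : realType) (Omega : ptopologicalType) :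
  polish_space R Omega ->
  measurable [set e : borel Omega * borel Omega | e.1 = e.2].
Proof.
move=> [[D /pcard_surjP[z zD] denseD] [dist [[dist0 dist_eq dist_sym dist_tri] dist_nbhs _]]].
pose ball n (x : Omega) := [set y : Omega | dist x y < n.+1%:R^-1]%R.
have open_ball n x : open (ball n x).
  rewrite openE => y; rewrite /ball/= => xy.
  rewrite /interior; apply/dist_nbhs; exists (n.+1%:R^-1 - dist x y)%R.
    by rewrite subr_gt0.
  move=> t /= yt; apply: le_lt_trans (dist_tri x y t) _.
  by rewrite -ltrBrDl.
have mball n x : measurable (ball n x : set (borel Omega)).
  exact: sub_sigma_algebra.
rewrite -[X in measurable X]setCK; apply: measurableC.
rewrite (_ : ~` _ = \bigcup_n \bigcup_m
    ((ball n (z m) : set (borel Omega)) `*` ~` (ball n (z m) : set (borel Omega)))).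
  apply: bigcup_measurable => n _; apply: bigcup_measurable => m _.
  by apply: measurableX => //; exact: measurableC.
apply/seteqP; split => [[x y] /= xy|[x y] [n _ [m _ [/= zx zy]]] xy]; last first.
  by apply: zy; rewrite -xy.
have r0 : (0 < dist x y)%R.
  by rewrite lt_def dist0 andbT; apply/eqP => /dist_eq.
have [n nr] : exists n, (n.+1%:R^-1 < dist x y / 2)%R.
  exists (Num.trunc (dist x y / 2)^-1).
  rewrite invf_plt ?posrE ?divr_gt0//.
  by rewrite truncnS_gt.
have [t [xt Dt]] : (ball n x `&` D) !=set0.
  apply: denseD => //; exists x; rewrite /ball/=.
  by have /dist_eq -> : x = x by [].
have [m _ mt] := zD _ Dt.
exists n => //; exists m => //; rewrite /ball/= mt; split => /=.
  by rewrite dist_sym.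
move=> ty; have := le_lt_trans (dist_tri x t y) (ltrD xt ty).
apply/negP; rewrite -leNgt; apply/ltW.
by rewrite [ltRHS](splitr (dist x y)) ltrD.
Qed.

(** * The variational principle *)

Theorem theorem1p1 (R : realType) (Omega : ptopologicalType)
  (Omega_polish : polish_space R Omega)
  (k : R.-ftker (borel Omega) ~> (borel Omega))
  (mu : {sigma_finite_measure set (borel Omega) -> \bar R})
  (mu_reversible : reversible mu k)
  (K_finite : joint mu k setT < +oo)
  (k_gt0 : {ae mu, forall x, 0 < k x setT})
  (d : measure_display) (W : measurableType d)
  (Px : R.-pker (borel Omega) ~> W)
  (Y : nat -> W -> borel Omega) (S : nat -> W -> \bar R)
  (X_jump : is_jump_process k Px Y S)
  (X_irreducible : irreducible Px Y S mu)
  (X_recurrent : recurrent Px Y S mu)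
  (A B : set (borel Omega)) (mA : measurable A) (mB : measurable B)
  (AB_disjoint : A `&` B = set0) :
  capacity k Px Y S mu A B =
    ge0_sup [set inverse_density_mean (joint mu k) P
         | P in path_laws (joint mu k) A B] /\
  capacity k Px Y S mu A B =
    ge0_sup [set inverse_density_mean (joint mu k) P
         | P in [set P | path_laws (joint mu k) A B P /\
                         P (paths A B `&` self_avoiding) = 1]].
Proof.
pose h := hitting_potential Px Y A B.
have mh : measurable_fun setT h by exact: (measurable_hitting_potential X_jump mA mB).
have h01 x : (0 <= h x <= 1)%R by exact: (hitting_potential01 X_jump mA mB x).
have hA x : A x -> h x = 1%R by exact: (hitting_potential_source X_jump mA mB).
have hB x : B x -> h x = 0%R by exact: (hitting_potential_sink X_jump mA mB AB_disjoint).
have harmonic : {ae mu, forall x, ~ A x -> ~ B x -> outflow k h x = inflow k h x}.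
  by apply: aeW => x; exact: (hitting_potential_harmonic X_jump mA mB).
have -> : capacity k Px Y S mu A B = energy mu k h.
  rewrite (energy_outflow mu_reversible K_finite mh h01 mA hA hB harmonic).
  exact: (capacityE X_jump mu_reversible X_recurrent mA mB AB_disjoint).
have energy0 : 0 <= energy mu k h.
  by apply: integral_ge0 => e _; rewrite lee_fin mulr_ge0// potential_drop_ge0.
have upper P : path_laws (joint mu k) A B P ->
    inverse_density_mean (joint mu k) P <= energy mu k h.
  exact: (inverse_density_mean_le K_finite mh mA mB hA hB).
have sup_le D : D `<=` path_laws (joint mu k) A B ->
    ge0_sup [set inverse_density_mean (joint mu k) P | P in D] <= energy mu k h.
  move=> DP; apply: ge_ereal_sup => _ [->//|[P DPP <-]].
  by apply: upper; exact: DP.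
suff le_sup (D : set (probability (seq (borel Omega)) R)) :
    (forall P, path_laws (joint mu k) A B P -> P (paths A B `&` self_avoiding) = 1 -> D P) ->
    energy mu k h <= ge0_sup [set inverse_density_mean (joint mu k) P | P in D].
  split; apply/eqP; rewrite eq_le; apply/andP; split.
  - by apply: le_sup.
  - by apply: sup_le.
  - by apply: le_sup => P.
  - by apply: sup_le => P [].
move=> DP; have [e0|epos] := eqVneq (energy mu k h) 0.
  by rewrite e0; apply: ereal_sup_ubound; left.
have efin : energy mu k h \is a fin_num.
  by rewrite ge0_fin_numE//; exact: (energy_fin K_finite mh h01).
have cE : energy mu k h = (fine (energy mu k h))%:E by rewrite fineK.
have c_gt0 : (0 < fine (energy mu k h))%R.
  by rewrite -lte_fin -cE lt_def epos.
have [P [PAB Psa leP]] := exists_optimal_law mu_reversible K_finite mh h01 mA mB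
  AB_disjoint hA hB harmonic c_gt0 cE (polish_diagonal_measurable Omega_polish).
apply: le_trans leP _; apply: ereal_sup_ubound; right; exists P => //.
exact: DP.
Qed.
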